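(* Let $K$ be a number field with ring of integers $R$, let $\mathfrak{m}$ be a modulus for $K$, let $\Gamma\subseteq(R/\mathfrak{m})^*$ be a subgroup, and let $P_{\mathfrak{m},\Gamma}:=R\rtimes R_{\mathfrak{m},\Gamma}$. In $C^*(P_{\mathfrak{m},\Gamma})$, for $x\in R$ let $u^x:=v_{(x,1)}$, for $a\in R_{\mathfrak{m},\Gamma}$ let $s_a:=v_{(0,a)}$, and for $\mathfrak{a}\in\mathcal{I}_{\mathfrak{m}}^+$ let $e_{\mathfrak{a}}:=e_{\mathfrak{a}\times(\mathfrak{a}\cap R_{\mathfrak{m},\Gamma})}$. Then: (Ta) The $u^x$ are unitary and satisfy $u^xu^y=u^{x+y}$, the $s_a$ are isometries and satisfy $s_as_b=s_{ab}$; moreover, $s_au^x=u^{ax}s_a$, for all $x,y\in R$ and $a,b\in R_{\mathfrak{m},\Gamma}$. (Tb) The $e_{\mathfrak{a}}$ are projections and satisfy $e_{\mathfrak{a}}e_{\mathfrak{b}}=e_{\mathfrak{a}\cap\mathfrak{b}}$ for $\mathfrak{a},\mathfrak{b}\in\mathcal{I}_{\mathfrak{m}}^+$, and $e_R=1$. (Tc) $s_ae_{\mathfrak{b}}s_a^*=e_{a\mathfrak{b}}$ for $a\in R_{\mathfrak{m},\Gamma}$, $\mathfrak{b}\in\mathcal{I}_{\mathfrak{m}}^+$. (Td) For $\mathfrak{a}\in\mathcal{I}_{\mathfrak{m}}^+$: $u^xe_{\mathfrak{a}}=e_{\mathfrak{a}}u^x$ for $x\in\mathfrak{a}$, and $e_{\mathfrak{a}}u^xe_{\mathfrak{a}}=0$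 for $x\in R\setminus\mathfrak{a}$. Moreover, $C^*(P_{\mathfrak{m},\Gamma})$ is universal in the following sense: if $B$ is a C*-algebra containing elements $U^x$ ($x\in R$), $S_a$ ($a\in R_{\mathfrak{m},\Gamma}$) and $E_{\mathfrak{a}}$ ($\mathfrak{a}\in\mathcal{I}_{\mathfrak{m}}^+$) satisfying the relations obtained from (Ta)–(Td) by replacing $u^x,s_a,e_{\mathfrak{a}}$ by $U^x,S_a,E_{\mathfrak{a}}$, then there is a unique *-homomorphism $C^*(P_{\mathfrak{m},\Gamma})\to B$ such that $u^x\mapsto U^x$, $s_a\mapsto S_a$, and $e_{\mathfrak{a}}\mapsto E_{\mathfrak{a}}$.
   Context: Number-theoretic notation. $R^\times:=R\setminus\{0\}$, $K^\times:=K\setminus\{0\}$; $\mathcal{P}_K$ is the set of non-zero prime ideals of $R$; $V_{K,\mathbb{R}}$ is the set of real embeddings of $K$; $\mathbb{N}$ contains $0$. A modulus $\mathfrak{m}$ for $K$ is a function $\mathfrak{m}:V_{K,\mathbb{R}}\sqcup\mathcal{P}_K\to\mathbb{N}$ such that $\mathfrak{m}_\infty:=\mathfrak{m}|_{V_{K,\mathbb{R}}}$ takes values in $\{0,1\}$ and $\mathfrak{m}(\mathfrak{p})=0$ for all but finitely many $\mathfrak{p}\in\mathcal{P}_K$. Put $\mathfrak{m}_0:=\prod_{\mathfrak{p}}\mathfrak{p}^{\mathfrak{m}(\mathfrak{p})}$, and write $w\mid\mathfrak{m}_\infty$ if $\mathfrak{m}_\infty(w)=1$. $(R/\mathfrak{m})^*:=\prod_{w\mid\mathfrak{m}_\infty}\{\pm1\}\times(R/\mathfrak{m}_0)^*$.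 $R_{\mathfrak{m}}:=\{a\in R^\times: v_{\mathfrak{p}}(a)=0\text{ for all }\mathfrak{p}\mid\mathfrak{m}_0\}$, and for $a\in R_{\mathfrak{m}}$, $[a]_{\mathfrak{m}}:=((\mathrm{sign}(w(a)))_{w\mid\mathfrak{m}_\infty},a+\mathfrak{m}_0)\in(R/\mathfrak{m})^*$. $R_{\mathfrak{m},\Gamma}:=\{a\in R_{\mathfrak{m}}:[a]_{\mathfrak{m}}\in\Gamma\}$, a multiplicative monoid. $\mathcal{I}_{\mathfrak{m}}^+$ is the monoid of non-zero integral ideals of $R$ coprime to $\mathfrak{m}_0$. $R\rtimes R_{\mathfrak{m},\Gamma}$ is the set of pairs $(b,a)$, $b\in R$, $a\in R_{\mathfrak{m},\Gamma}$, with product $(b,a)(d,c)=(b+ad,ac)$; it is a unital subsemigroup of the group $K\rtimes K^\times$. Semigroup C*-algebra. For a unital subsemigroup $P$ of a countable group $G$, $p\in P$, $X\subseteq P$, let $pX=\{px:x\in X\}$ and $p^{-1}(X)=\{p^{-1}x\in G:x\in X\}\cap P$. $\mathcal{J}_P$ (the constructible right ideals of $P$) is the smallest collection of subsets of $P$ containing $\emptyset$ and $P$, closed under $X\mapsto pX$ and $X\mapsto p^{-1}(X)$ for $p\in P$, and under finite intersections. $C^*(P)$ is the universal C*-algebra generated by isometries $\{v_p:p\in P\}$ and projections $\{e_X:X\in\mathcal{J}_P\}$ such that (I) $v_pv_q=v_{pq}$ and $v_pe_Xv_p^*=e_{pX}$; (II) $e_\emptyset=0$, $e_P=1$, $e_Xe_Y=e_{X\cap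 Y}$, for all $p,q\in P$, $X,Y\in\mathcal{J}_P$. For $P=P_{\mathfrak{m},\Gamma}$, the non-empty constructible right ideals are exactly the sets $(x+\mathfrak{a})\times(\mathfrak{a}\cap R_{\mathfrak{m},\Gamma})$ with $x\in R$, $\mathfrak{a}\in\mathcal{I}_{\mathfrak{m}}^+$. *)

(* Defs.v *)
From HB Require Import structures.
From mathcomp Require Import all_boot all_order all_fingroup all_algebra all_field.
From mathcomp Require Import finmap.
From mathcomp Require Import all_classical all_reals all_analysis.
From mathcomp Require Import complex.

Set Implicit Arguments.
Unset Strict Implicit.
Unset Printing Implicit Defensive.

Import Order.TTheory GRing.Theory Num.Theory.
Import numFieldNormedType.Exports.

Local Open Scope classical_set_scope.
Local Open Scope complex_scope.
Local Open Scope ring_scope.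

(* Unital C*-algebras. The zero algebra is allowed, which excludes [algType]
   (it imposes 1 != 0). Multiplication is part of the mixin because the
   hierarchy has no join of rings and normed modules; the ring structure is
   derived just below. The norm takes its values in [RR[i]], as for every normed
   module over [RR[i]]. *)
HB.mixin Record isCStarAlgebra (RR : realType) A
    of CompleteNormedModule RR[i] A := {
  cstar_one : A ;
  cstar_mul : A -> A -> A ;
  star : A -> A ;
  cstar_mulA : associative cstar_mul ;
  cstar_mul1x : left_id cstar_one cstar_mul ;
  cstar_mulx1 : right_id cstar_one cstar_mul ;
  cstar_mulDl : left_distributive cstar_mul +%R ;
  cstar_mulDr : right_distributive cstar_mul +%R ;
  cstar_scaleAl : forall (k : RR[i]) (x y : A),
    k *: cstar_mul x y = cstar_mul (k *: x) y ;
  cstar_scaleAr : forall (k : RR[i]) (x y : A),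
    k *: cstar_mul x y = cstar_mul x (k *: y) ;
  cstar_normM : forall x y : A, `|cstar_mul x y| <= `|x| * `|y| ;
  starK : involutive star ;
  starD : {morph star : x y / x + y} ;
  starZ : forall (k : RR[i]) (x : A), star (k *: x) = k^* *: star x ;
  cstar_starM : forall x y : A, star (cstar_mul x y) = cstar_mul (star y) (star x) ;
  cstar_normE : forall x : A, `|cstar_mul (star x) x| = `|x| ^+ 2
}.

#[short(type="cstarAlgType")]
HB.structure Definition CStarAlgebra (RR : realType) :=
  { A of CompleteNormedModule RR[i] A & isCStarAlgebra RR A }.

HB.instance Definition _ (RR : realType) (A : cstarAlgType RR) :=
  GRing.Zmodule_isPzRing.Build (CStarAlgebra.sort A)
    cstar_mulA cstar_mul1x cstar_mulx1 cstar_mulDl cstar_mulDr.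

Section CStarVocabulary.
Variable RR : realType.

Lemma cstar_scalerAl (A : cstarAlgType RR) (k : RR[i]) (x y : A) :
  k *: (x * y) = (k *: x) * y.
Proof. exact: cstar_scaleAl. Qed.

Lemma cstar_scalerAr (A : cstarAlgType RR) (k : RR[i]) (x y : A) :
  k *: (x * y) = x * (k *: y).
Proof. exact: cstar_scaleAr. Qed.

Lemma cstar_ler_normM (A : cstarAlgType RR) (x y : A) :
  `|x * y| <= `|x| * `|y|.
Proof. exact: cstar_normM. Qed.

Lemma starM (A : cstarAlgType RR) (x y : A) : star (x * y) = star y * star x.
Proof. exact: cstar_starM. Qed.

Lemma norm_starM (A : cstarAlgType RR) (x : A) : `|star x * x| = `|x| ^+ 2.
Proof. exact: cstar_normE. Qed.

Definition star_hom (A B : cstarAlgType RR) (f : A -> B) : Prop :=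
  [/\ linear f, {morph f : x y / x * y} & {morph f : x / star x}].

Variable A : cstarAlgType RR.

Definition isometry (x : A) : Prop := star x * x = 1.
Definition unitary (x : A) : Prop := star x * x = 1 /\ x * star x = 1.
Definition projection (x : A) : Prop := star x = x /\ x * x = x.

End CStarVocabulary.

Section SemigroupAlgebra.
Variables (RR : realType) (G : groupType) (P : set G).

Definition ltranslate (p : G) (X : set G) : set G := [set (p * x)%g | x in X].
Definition lpreimage (p : G) (X : set G) : set G :=
  [set (p^-1 * x)%g | x in X] `&` P.

Inductive constructible : set G -> Prop :=
| constructible0 : constructible set0
| constructibleT : constructible P
| constructibleM p X : P p -> constructible X -> constructible (ltranslate p X)
| constructibleV p X : P p -> constructible X -> constructible (lpreimage p X)
| constructibleI X Y :
    constructible X -> constructible Y -> constructible (X `&` Y).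

(* The generators are given by total functions on [G] and [set G]; only their
   values on [P] and on constructible right ideals are constrained. *)
Record semigroup_relations (A : cstarAlgType RR) (v : G -> A) (e : set G -> A)
    : Prop := {
  rel_isometry : forall p, P p -> isometry (v p) ;
  rel_projection : forall X, constructible X -> projection (e X) ;
  rel_vM : forall p q, P p -> P q -> v p * v q = v (p * q)%g ;
  rel_ve : forall p X, P p -> constructible X ->
    v p * e X * star (v p) = e (ltranslate p X) ;
  rel_e0 : e set0 = 0 ;
  rel_eT : e P = 1 ;
  rel_eI : forall X Y, constructible X -> constructible Y ->
    e X * e Y = e (X `&` Y)
}.

(* [(A, v, e)] is C*(P), i.e. it is universal among the families satisfying the
   relations. Uniqueness of the homomorphisms expresses that [A] is generated
   by the [v p] and the [e X]. *)
Definition is_semigroup_cstar (A : cstarAlgType RR) (v : G -> A)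
    (e : set G -> A) : Prop :=
  semigroup_relations v e /\
  forall (B : cstarAlgType RR) (V : G -> B) (E : set G -> B),
    semigroup_relations V E ->
    exists! f : A -> B,
      [/\ star_hom f, forall p, P p -> f (v p) = V p
        & forall X, constructible X -> f (e X) = E X].

End SemigroupAlgebra.

Section AffineGroup.
Variable K : fieldType.

(* The group K \rtimes K^*. *)
Definition affine : Type := {x : K * K | x.2 != 0}.

HB.instance Definition _ := Choice.on affine.

Definition affine1 : affine :=
  exist (fun x : K * K => x.2 != 0) (0, 1) (oner_neq0 K).

(* The pair [(b, a)]; the value at [a = 0] is irrelevant. *)
Definition aff (b a : K) : affine := insubd affine1 (b, a).

Definition affineM (x y : affine) : affine :=
  aff ((val x).1 + (val x).2 * (val y).1) ((val x).2 * (val y).2).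
Definition affineV (x : affine) : affine :=
  aff (- ((val x).2^-1 * (val x).1)) (val x).2^-1.

Lemma val_aff b a : a != 0 -> val (aff b a) = (b, a).
Proof. by move=> a0; rewrite /aff val_insubd /= a0. Qed.

Lemma val_affineM x y : val (affineM x y) =
  ((val x).1 + (val x).2 * (val y).1, (val x).2 * (val y).2).
Proof. by rewrite val_aff // mulf_neq0 ?(valP x) ?(valP y). Qed.

Lemma val_affineV x : val (affineV x) =
  (- ((val x).2^-1 * (val x).1), (val x).2^-1).
Proof. by rewrite val_aff // invr_neq0 ?(valP x). Qed.

Lemma affineMA : associative affineM.
Proof.
move=> x y z; apply: val_inj; rewrite !val_affineM /=.
by rewrite mulrDr !mulrA addrA.
Qed.

Lemma affine1M : left_id affine1 affineM.
Proof.
move=> x; apply: val_inj; rewrite val_affineM /= add0r !mul1r.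
by case: (val x).
Qed.

Lemma affineM1 : right_id affine1 affineM.
Proof.
move=> x; apply: val_inj; rewrite val_affineM /= mulr0 addr0 mulr1.
by case: (val x).
Qed.

Lemma affineVM : left_inverse affine1 affineV affineM.
Proof.
move=> x; apply: val_inj; rewrite val_affineM val_affineV /= addNr.
by rewrite mulVf ?(valP x).
Qed.

Lemma affineMV : right_inverse affine1 affineV affineM.
Proof.
move=> x; apply: val_inj; rewrite val_affineM val_affineV /= mulrN mulrA.
by rewrite divff ?(valP x) // mul1r subrr.
Qed.

HB.instance Definition _ :=
  isGroup.Build affine affineMA affine1M affineM1 affineVM affineMV.

End AffineGroup.

Section NumberField.
Variable K : fieldExtType rat.

Definition int_ring : set K := [set x | integralOver (intr : int -> K) x].

(* Ideals of the ring of integers, as subsets of [K]. *)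
Record is_ideal (I : set K) : Prop := {
  ideal_sub : I `<=` int_ring ;
  ideal0 : I 0 ;
  idealD : forall x y, I x -> I y -> I (x + y) ;
  idealMl : forall a x, int_ring a -> I x -> I (a * x)
}.

Definition ideal_mul (I J : set K) : set K :=
  [set z | exists (n : nat) (x y : 'I_n -> K),
    [/\ forall i, I (x i), forall i, J (y i) & z = \sum_(i < n) x i * y i]].

Definition ideal_exp (I : set K) (n : nat) : set K :=
  iter n (ideal_mul I) int_ring.

Definition ideal_dvd (I J : set K) : Prop :=
  exists2 L, is_ideal L & J = ideal_mul I L.

Definition ideal_coprime (I J : set K) : Prop :=
  [set x + y | x in I & y in J] = int_ring.

Definition scale (a : K) (I : set K) : set K := [set a * x | x in I].
Definition coset (a : K) (I : set K) : set K := [set a + x | x in I].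

Record is_nzprime (p : set K) : Prop := {
  nzprime_ideal : is_ideal p ;
  nzprime_proper : p <> int_ring ;
  nzprime_nz : p <> [set 0] ;
  nzprime_mul : forall x y, int_ring x -> int_ring y ->
    p (x * y) -> p x \/ p y
}.

Definition nzprime : Type := {p : set K | `[< is_nzprime p >]}.

(* [valuation p a n] means v_p(a) = n (for [a] in the ring of integers). *)
Definition valuation (p : nzprime) (a : K) (n : nat) : Prop :=
  ideal_exp (val p) n a /\ ~ ideal_exp (val p) n.+1 a.

Variable RR : realType.

Record modulus := Modulus {
  modulus_fun :> {rmorphism K -> RR} + nzprime -> nat ;
  modulus_inf : forall w, (modulus_fun (inl w) <= 1)%N ;
  modulus_fin : finite_set [set p | modulus_fun (inr p) != 0%N]
}.

Variable m : modulus.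

Definition modulus0 : set K :=
  \big[ideal_mul/int_ring]_(p <- fset_set [set p | m (inr p) != 0%N])
    ideal_exp (val p) (m (inr p)).

Definition inf_place : Type := {w : {rmorphism K -> RR} | m (inl w) == 1%N}.

(* An element of (R/m)^* is a family of signs together with a coset of the
   ideal [modulus0], which is a unit of the quotient ring. *)
Definition residue : Type := ((inf_place -> int) * set K)%type.

Definition residue_units : set residue :=
  [set x | (forall w, x.1 w = 1 \/ x.1 w = -1) /\
    exists a b, [/\ int_ring a, int_ring b, x.2 = coset a modulus0
                  & modulus0 (a * b - 1)]].

Definition residue1 : residue := (fun _ => 1, coset 1 modulus0).

Definition residueM (x y : residue) : residue :=
  (fun w => x.1 w * y.1 w,
   [set z | exists a b c, [/\ x.2 a, y.2 b, modulus0 c & z = a * b + c]]).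

Record residue_subgroup (Gamma : set residue) : Prop := {
  rsub_units : Gamma `<=` residue_units ;
  rsub_one : Gamma residue1 ;
  rsub_mul : forall x y, Gamma x -> Gamma y -> Gamma (residueM x y) ;
  rsub_inv : forall x y, Gamma x -> residue_units y ->
    residueM x y = residue1 -> Gamma y
}.

Definition residue_class (a : K) : residue :=
  (fun w => sgz ((val w : {rmorphism K -> RR}) a), coset a modulus0).

(* The monoid R_m. *)
Definition int_coprime : set K :=
  [set a | [/\ int_ring a, a != 0 & forall p : nzprime,
    ideal_dvd (val p) modulus0 -> valuation p a 0]].

(* The monoid I_m^+. *)
Definition ideals_coprime : set (set K) :=
  [set I | [/\ is_ideal I, I <> [set 0] & ideal_coprime I modulus0]].

Variable Gamma : set residue.

(* The monoid R_{m,Gamma}. *)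
Definition congruence_monoid : set K :=
  [set a | int_coprime a /\ Gamma (residue_class a)].

(* The semigroup P_{m,Gamma}, inside the group K \rtimes K^*. *)
Definition affine_semigroup : set (affine K) :=
  [set g | int_ring (val g).1 /\ congruence_monoid (val g).2].

(* The right ideal I x (I \cap R_{m,Gamma}). *)
Definition affine_ideal (I : set K) : set (affine K) :=
  [set g | I (val g).1 /\ (I `&` congruence_monoid) (val g).2].

(* As above, [u], [s], [e] are total functions whose values matter only on the
   ring of integers, on R_{m,Gamma} and on I_m^+ respectively. *)
Section Relations.
Variables (A : cstarAlgType RR) (u s : K -> A) (e : set K -> A).

Record relations_Ta : Prop := {
  Ta_unitary : forall x, int_ring x -> unitary (u x) ;
  Ta_uD : forall x y, int_ring x -> int_ring y -> u x * u y = u (x + y) ;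
  Ta_isometry : forall a, congruence_monoid a -> isometry (s a) ;
  Ta_sM : forall a b, congruence_monoid a -> congruence_monoid b ->
    s a * s b = s (a * b) ;
  Ta_su : forall a x, congruence_monoid a -> int_ring x ->
    s a * u x = u (a * x) * s a
}.

Record relations_Tb : Prop := {
  Tb_projection : forall I, ideals_coprime I -> projection (e I) ;
  Tb_eI : forall I J, ideals_coprime I -> ideals_coprime J ->
    e I * e J = e (I `&` J) ;
  Tb_e1 : e int_ring = 1
}.

Definition relations_Tc : Prop :=
  forall a I, congruence_monoid a -> ideals_coprime I ->
    s a * e I * star (s a) = e (scale a I).

Record relations_Td : Prop := {
  Td_in : forall I x, ideals_coprime I -> I x -> u x * e I = e I * u x ;
  Td_out : forall I x, ideals_coprime I -> (int_ring `\` I) x ->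
    e I * u x * e I = 0
}.

Definition relations_T : Prop :=
  [/\ relations_Ta, relations_Tb, relations_Tc & relations_Td].

End Relations.

End NumberField.

(* Main.v *)
Require Import Defs.
From mathcomp Require Import all_boot all_order all_fingroup all_algebra all_field.
From mathcomp Require Import all_classical all_reals all_analysis.
From mathcomp Require Import ring lra.

(** The two presentations define the same families of operators, up to the
    dictionary [V (b, a) = U^b S_a] and [E_X = U^x E_I (U^x)^*] for
    [X = (x + I) x (I \cap R_{m,Gamma})]; the theorem is then a transport of the
    universal property.

    The dictionary requires that the non-empty constructible right ideals are
    exactly these sets [X], with [I] an integral ideal coprime to [m0]. That each
    of them has this form is a direct induction over the closure operations
    ([constructible_affine_coset]). That each [I \times (I \cap R_{m,Gamma})] is
    constructible is the arithmetic core: [I] has to be a finite intersection of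
    ideals [{x : b x \in a R}] with [a], [b] in [R_{m,Gamma}]
    ([coprime_ideal_quotients]). This comes from [I = (I^-1)^-1], applied to
    finitely many generators of [a I^-1] modulo [a], each moved into
    [R_{m,Gamma}] by a congruence and a positivity argument.

    Invertibility of ideals is obtained without prime factorization. The
    quotients [R / n R] are finite ([finite_quotient]), since families that are
    independent modulo a prime [p] are free over the rationals. In a finite ring
    every proper ideal is annihilated by a non-zero element, so a proper ideal
    [I] of [R] has [x I <= R] for some non-integral [x] ([proper_ideal_inv]).
    If [I I^-1] were proper, such an [x] would satisfy [x I^-1 <= I^-1]; its
    powers would have bounded denominators, and by finiteness [x] would be a root
    of a monic polynomial [X^l - X^k - r], hence integral ([ideal_mul_inv]).

    On the operator side, the dictionary is well defined because a set [X]
    determines [I] and the class of [x] modulo [I], while (Td) makes [E_I] commute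
    with [U^d] for [d] in [I]. Multiplicativity of [X |-> E_X] on disjoint sets
    with different ideals [I] and [J] reduces to (Td) for the ideal [I + J]
    ([coset_projection_disjoint]). Uniqueness holds since the [u^x], [s_a] and
    [e_I] generate all the [v_p] and [e_X]. *)

Set Implicit Arguments.
Unset Strict Implicit.
Unset Printing Implicit Defensive.
Import Order.TTheory GRing.Theory Num.Theory.
Local Open Scope classical_set_scope.
Local Open Scope ring_scope.

(** * Ideals of the ring of integers *)

Section Integers.
Variable K : fieldExtType rat.
Local Notation R := (@int_ring K).
Implicit Types (x y z : K) (I J : set K) (n : nat).

Lemma int_ring_int (k : int) : R k%:~R.
Proof. exact: (integral_id (intr : {rmorphism int -> K})). Qed.

Lemma int_ring_nat n : R n%:R.
Proof. exact: mxpoly.integral_nat. Qed.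

Lemma int_ring0 : R 0. Proof. exact: mxpoly.integral0. Qed.
Lemma int_ring1 : R 1. Proof. exact: mxpoly.integral1. Qed.

Lemma int_ringD x y : R x -> R y -> R (x + y).
Proof. exact: mxpoly.integral_add. Qed.

Lemma int_ringN x : R x -> R (- x).
Proof. exact: mxpoly.integral_opp. Qed.

Lemma int_ringB x y : R x -> R y -> R (x - y).
Proof. exact: mxpoly.integral_sub. Qed.

Lemma int_ringM x y : R x -> R y -> R (x * y).
Proof. exact: mxpoly.integral_mul. Qed.

Lemma int_ringX x n : R x -> R (x ^+ n).
Proof.
move=> Rx; elim: n => [|n IH]; first exact: int_ring1.
by rewrite exprS; apply: int_ringM.
Qed.

Lemma int_ring_sum (T : Type) (s : seq T) (F : T -> K) :
  (forall i, R (F i)) -> R (\sum_(i <- s) F i).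
Proof. by move=> RF; apply: (big_ind R int_ring0 int_ringD) => i _. Qed.

Lemma int_ring_ideal : is_ideal R.
Proof.
split=> //; [exact: int_ring0 | exact: int_ringD | exact: int_ringM].
Qed.

Lemma idealN I x : is_ideal I -> I x -> I (- x).
Proof.
move=> idI Ix; rewrite -mulN1r; apply: idealMl => //.
exact/int_ringN/int_ring1.
Qed.

Lemma idealB I x y : is_ideal I -> I x -> I y -> I (x - y).
Proof. by move=> idI Ix Iy; apply: idealD => //; apply: idealN. Qed.

Lemma idealMr I a x : is_ideal I -> R a -> I x -> I (x * a).
Proof. by move=> idI Ra Ix; rewrite mulrC; apply: idealMl. Qed.

Lemma ideal_eq_int_ring I : is_ideal I -> I 1 -> I = R.
Proof.
move=> idI I1; apply/seteqP; split; first exact: ideal_sub.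
by move=> x Rx; rewrite -[x]mulr1; apply: idealMl.
Qed.

Lemma scale_ideal a I : R a -> is_ideal I -> is_ideal (scale a I).
Proof.
move=> Ra idI; split.
- by move=> _ [x Ix <-]; apply: int_ringM => //; apply: ideal_sub Ix.
- by exists 0; [exact: ideal0 | rewrite mulr0].
- move=> _ _ [x Ix <-] [y Iy <-].
  by exists (x + y); [exact: idealD | rewrite mulrDr].
- move=> b _ Rb [x Ix <-]; exists (b * x); first exact: idealMl.
  by rewrite mulrCA.
Qed.

Lemma ideal_mul_ideal I J :
  is_ideal I -> (forall x y, I x -> J y -> R (x * y)) ->
  is_ideal (ideal_mul I J).
Proof.
move=> idI RIJ; split.
- move=> _ [n [x [y [Ix Jy ->]]]]; apply: int_ring_sum => i; exact: RIJ.
- by exists 0, (fun=> 0), (fun=> 0); split; [case | case | rewrite big_ord0].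
- move=> _ _ [n [x [y [Ix Jy ->]]]] [n' [x' [y' [Ix' Jy' ->]]]].
  exists (n + n')%N,
    (fun i : 'I_(n + n') =>
       match fintype.split i with inl j => x j | inr j => x' j end),
    (fun i : 'I_(n + n') =>
       match fintype.split i with inl j => y j | inr j => y' j end).
  split=> [i|i|]; [by case: (fintype.split i) | by case: (fintype.split i) |].
  by rewrite big_split_ord; congr (_ + _); apply: eq_bigr => i _;
    [rewrite (unsplitK (inl _)) | rewrite (unsplitK (inr _))].
- move=> a _ Ra [n [x [y [Ix Jy ->]]]].
  exists n, (fun i => a * x i), y; split=> // [i|]; first exact: idealMl.
  by rewrite mulr_sumr; apply: eq_bigr => i _; rewrite mulrA.
Qed.

Lemma ideal_mul_mem I J x y : I x -> J y -> ideal_mul I J (x * y).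
Proof.
move=> Ix Jy; exists 1, (fun=> x), (fun=> y); split=> //.
by rewrite big_ord_recl big_ord0 addr0.
Qed.

Lemma ideal_mul_subl I J : is_ideal I -> J `<=` R -> ideal_mul I J `<=` I.
Proof.
move=> idI JR _ [n [x [y [Ix Jy ->]]]].
apply: (big_ind I) => [|u v|i _]; [exact: ideal0 | exact: idealD |].
by apply: idealMr => //; apply: JR.
Qed.

Lemma charK n : (n%:R == 0 :> K) = (n == 0%N).
Proof.
have -> : n%:R = (n%:R : rat)%:A :> K by rewrite scaler_nat.
by rewrite scaler_eq0 oner_eq0 orbF pnatr_eq0.
Qed.

Lemma int_ring_horner (p : {poly int}) x :
  R x -> R (map_poly intr p).[x].
Proof.
move=> Rx; apply: integral_horner Rx; apply/integral_poly => i.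
by rewrite coef_map; apply: int_ring_int.
Qed.

(** A monic integral equation of [x] of least degree has a non-zero constant
    term, which is a multiple of [x]. *)
Lemma nat_in_ideal I x :
  is_ideal I -> I x -> x != 0 -> exists2 n, (0 < n)%N & I n%:R.
Proof.
move=> idI Ix x0.
have Rx : R x by exact: ideal_sub Ix.
have [p mp px] := Rx.
elim/poly_ind: p mp px => [|q c IH]; first by rewrite monicE lead_coef0.
have [->|c0] := eqVneq c 0 => mp px.
  apply: IH; first by move: mp; rewrite addr0 !monicE lead_coefMX.
  move: px; rewrite addr0 rmorphM /= map_polyX rootM => /orP[//|].
  by rewrite rootX (negPf x0).
have Ic : I c%:~R.
  move: px; rewrite /root rmorphD rmorphM /= map_polyX map_polyC /=.
  rewrite hornerD hornerMX hornerC addrC addr_eq0 => /eqP ->.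
  by apply: (idealN idI); apply: (idealMl idI) Ix; apply: int_ring_horner.
exists `|c|%N; first by rewrite absz_gt0.
rewrite pmulrn abszE; case: (ger0P c) => // _.
by rewrite rmorphN; apply: idealN.
Qed.

(** Linear independence over the prime field of the images of the [r i] in the
    quotient of the ring of integers by [p]. *)
Definition independent_mod (p n : nat) (r : 'I_n -> K) : Prop :=
  forall c : 'I_n -> int, scale p%:R R (\sum_(i < n) (c i)%:~R * r i) ->
    forall i, (p %| c i)%Z.

Lemma scale_int (c : int) x : (c%:~R : rat) *: x = c%:~R * x.
Proof. by rewrite scaler_int mulrzl. Qed.

(** Infinite descent: the coefficients of an integral relation are divisible by
    [p], and dividing them by [p] gives another relation, so they are divisible
    by every power of [p]. *)
Lemma int_relation_trivial p n (r : 'I_n -> K) (c : 'I_n -> int) :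
  prime p -> independent_mod p r -> \sum_(i < n) (c i)%:~R * r i = 0 ->
  forall i, c i = 0.
Proof.
move=> pp ind.
have H k : forall c : 'I_n -> int, \sum_(i < n) (c i)%:~R * r i = 0 ->
    forall i, ((p ^ k)%N %| c i)%Z.
  elim: k => [|k IH] {}c c0 i; first by rewrite expn0 dvd1z.
  have pc j : (p %| c j)%Z.
    by apply: ind; rewrite c0; exists 0; [exact: int_ring0 | rewrite mulr0].
  pose c' j := (c j %/ p)%Z.
  have Ec j : c j = c' j * p by rewrite /c' divzK.
  have c'0 : \sum_(j < n) (c' j)%:~R * r j = 0.
    have p0 : (p%:R : K) != 0 by rewrite charK -lt0n prime_gt0.
    apply: (mulfI p0); rewrite mulr0 -[RHS]c0 mulr_sumr.
    by apply: eq_bigr => j _; rewrite (Ec j) rmorphM /= -pmulrn; ring.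
  by rewrite Ec expnSr PoszM dvdz_mul // IH.
move=> c0 i; apply/eqP; rewrite -absz_eq0.
have := H `|c i|%N c c0 i; rewrite dvdzE absz_nat.
have [//|ci0] := posnP `|c i|%N.
by move/dvdn_leq => /(_ ci0); rewrite leqNgt ltn_expl ?prime_gt1.
Qed.

(** Clearing denominators turns a rational relation into an integral one, so a
    family independent modulo [p] is free over the rationals. Hence the
    quotient by [p] has dimension at most the degree of [K]. *)
Lemma independent_mod_bound p n (r : 'I_n -> K) :
  prime p -> independent_mod p r -> (n <= \dim {: K})%N.
Proof.
move=> pp ind; pose X := [tuple r i | i < n].
suff : free X by rewrite /free size_tuple => /eqP <-; apply/dimvS/subvf.
apply/freeP => k k0 i.
pose D := \prod_(j < n) denq (k j).
have D0 : D != 0 by apply/prodf_neq0 => j _; apply: denq_neq0.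
pose c j := numq (k j) * \prod_(l < n | l != j) denq (k l).
have Ec j : (c j)%:~R = D%:~R * k j :> rat.
  have -> : D = denq (k j) * \prod_(l < n | l != j) denq (k l).
    by rewrite /D (bigD1 j).
  rewrite /c !intrM -{3}[k j]divq_num_den.
  by field; rewrite intr_eq0 denq_neq0.
have /(int_relation_trivial pp ind) /(_ i) ci0 :
    \sum_(j < n) (c j)%:~R * r j = 0.
  rewrite (eq_bigr (fun j => (D%:~R : rat) *: (k j *: X`_j))) => [|j _].
    by rewrite -scaler_sumr k0 scaler0.
  by rewrite scalerA -Ec scale_int (nth_map j) ?size_enum_ord // nth_ord_enum.
have /eqP := Ec i; rewrite ci0 eq_sym mulf_eq0 intr_eq0 (negPf D0) /=.
by move/eqP.
Qed.

(** A maximal family independent modulo [p] spans the quotient; its combinations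
    with coefficients in [0, p[ represent all classes. *)
Lemma finite_quotient_prime p : prime p ->
  exists L : seq K, forall x, R x -> exists2 y, y \in L & scale p%:R R (x - y).
Proof.
move=> pp.
pose P n :=
  `[< exists r : 'I_n -> K, (forall i, R (r i)) /\ independent_mod p r >].
have exP : exists n, P n.
  by exists 0%N; apply/asboolP; exists (fun=> 0); split => [[]//|c _ []].
have bP n : P n -> (n <= \dim {: K})%N.
  by move/asboolP => [r [_ /(independent_mod_bound pp)]].
case: (ex_maxnP exP bP) => n /asboolP[r [Rr ind]] maxn.
exists [seq \sum_(i < n) (f i)%:R * r i | f : {ffun 'I_n -> 'I_p}] => x Rx.
(* [r'] is [r] with [x] put in front; by maximality it is dependent, and the
   coefficient of [x] in a relation is invertible modulo [p]. *)
pose r' (i : 'I_n.+1) := if unlift ord0 i is Some j then r j else x.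
have Rr' i : R (r' i) by rewrite /r'; case: unliftP.
have : ~ independent_mod p r'.
  move=> ind'; have /maxn : P n.+1 by apply/asboolP; exists r'.
  by rewrite ltnn.
move=> /existsNP[c /not_implyP[cp /existsNP[i0 /negP nci0]]].
have Es : \sum_(i < n.+1) (c i)%:~R * r' i =
    (c ord0)%:~R * x + \sum_(i < n) (c (lift ord0 i))%:~R * r i.
  rewrite big_ord_recl /r' unlift_none; congr (_ + _).
  by apply: eq_bigr => i _; rewrite liftK.
have pR : is_ideal (scale p%:R R).
  exact: scale_ideal (int_ring_nat _) int_ring_ideal.
have nc0 : ~~ (p %| c ord0)%Z.
  apply/negP => /dvdzP[q Eq]; move: nci0.
  case: (unliftP ord0 i0) => [j|] ->; last by rewrite Eq dvdz_mull.
  move/negP; apply; apply: (ind (fun i => c (lift ord0 i))).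
  rewrite (_ : \sum_(i < n) _ =
      (\sum_(i < n.+1) (c i)%:~R * r' i) - p%:R * (q%:~R * x)).
    apply: idealB => //; exists (q%:~R * x) => //.
    by apply: int_ringM => //; apply: int_ring_int.
  by rewrite Es Eq rmorphM /= -pmulrn; ring.
have [u [v uv]] : exists u v : int, u * c ord0 + v * p = 1.
  have : coprimez (c ord0) p.
    rewrite /coprimez -[gcdz _ _]/(Posz (gcdn _ _)) eqz_nat gcdnC.
    by rewrite -/(coprime _ _) prime_coprime // -dvdzE.
  by case/coprimezP => -[u v] uv; exists u, v.
(* [u] inverts the coefficient of [x]: [x = sum d_i r_i] modulo [p]. *)
pose d i := - u * c (lift ord0 i).
have p0 : (p : int) != 0 by rewrite -lt0n prime_gt0.
have dlt i : (`|(d i %% p)%Z|%N < p)%N.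
  by rewrite -ltz_nat gez0_abs ?modz_ge0 // ltz_pmod // ltz_nat prime_gt0.
pose f := [ffun i => Ordinal (dlt i)].
exists (\sum_(i < n) (f i)%:R * r i).
  by apply/mapP; exists f; rewrite ?mem_enum.
have -> : x - \sum_(i < n) (f i)%:R * r i =
  u%:~R * (\sum_(i < n.+1) (c i)%:~R * r' i) + p%:R * (v%:~R * x +
   \sum_(i < n) ((d i %/ p)%Z)%:~R * r i).
  have -> : x - \sum_(i < n) (f i)%:R * r i =
      (u * c ord0 + v * p)%:~R * x - \sum_(i < n) (f i)%:R * r i.
    by rewrite uv mul1r.
  have -> : \sum_(i < n) (f i)%:R * r i =
      - (u%:~R * \sum_(i < n) (c (lift ord0 i))%:~R * r i)
      - p%:R * (\sum_(i < n) ((d i %/ p)%Z)%:~R * r i).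
    rewrite !mulr_sumr -!sumrN -big_split; apply: eq_bigr => i _ /=.
    rewrite ffunE /= [X in X * _]pmulrn gez0_abs ?modz_ge0 //.
    have -> : (d i %% p)%Z = d i - (d i %/ p)%Z * p.
      by rewrite {2}(divz_eq (d i) p) addrC addKr.
    by rewrite /d !rmorphB /= !rmorphM /= rmorphN -pmulrn; ring.
  by rewrite Es rmorphD !rmorphM /= -pmulrn; ring.
apply: (idealD pR).
  by apply: idealMl => //; apply: int_ring_int.
exists (v%:~R * x + \sum_(i < n) ((d i %/ p)%Z)%:~R * r i) => //.
apply: int_ringD; first by apply: int_ringM Rx; apply: int_ring_int.
by apply: int_ring_sum => i; apply: int_ringM (Rr i); apply: int_ring_int.
Qed.

(** The index is multiplicative along prime factors of [n]: if the [y] represent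
    the classes modulo [p] and the [z] those modulo [n / p], the [y + p z]
    represent the classes modulo [n]. *)
Lemma finite_quotient n : (0 < n)%N ->
  exists L : seq K, forall x, R x -> exists2 y, y \in L & scale n%:R R (x - y).
Proof.
elim/ltn_ind: n => n IH n0.
have [n1|n1] := leqP n 1.
  exists [:: 0] => x Rx; exists 0; first by rewrite inE.
  have -> : n = 1%N by apply/eqP; rewrite eqn_leq n1 n0.
  by exists x; rewrite // mul1r subr0.
have pp := pdiv_prime n1; set p := pdiv n in pp.
have En : n = (p * (n %/ p))%N by rewrite mulnC divnK // pdiv_dvd.
have [L HL] := finite_quotient_prime pp.
have [||M HM] := IH (n %/ p)%N.
- by rewrite ltn_Pdiv // prime_gt1.
- by rewrite divn_gt0 ?prime_gt0 // pdiv_leq.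
exists [seq y + p%:R * z | y <- L, z <- M] => x /HL[y Ly [x' Rx' Ex]].
have [z Mz [x'' Rx'' Ex']] := HM _ Rx'.
exists (y + p%:R * z); first by apply/allpairsP; exists (y, z).
exists x'' => //; rewrite En natrM -mulrA Ex' mulrBr Ex; ring.
Qed.

(** Representatives taken inside [I] itself. For an ideal containing [n] they
    generate it modulo [n], which replaces noetherianity. *)
Lemma subset_representatives n I : (0 < n)%N -> I `<=` R ->
  exists l : seq K, (forall y, y \in l -> I y) /\
    forall x, I x -> exists2 y, y \in l & scale n%:R R (x - y).
Proof.
move=> n0 IR; have nR : is_ideal (scale n%:R R).
  exact: scale_ideal (int_ring_nat _) int_ring_ideal.
have [L HL] := finite_quotient n0.
suff [l [lI Hl]] : exists l : seq K, (forall y, y \in l -> I y) /\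
    forall x z, z \in L -> I x -> scale n%:R R (x - z) ->
      exists2 y, y \in l & scale n%:R R (x - y).
  by exists l; split=> // x Ix; have [z Lz] := HL x (IR x Ix); apply: Hl.
elim: L {HL} => [|z L [l [lI Hl]]]; first by exists [::].
have [[w [Iw wz]]|nw] := pselect (exists w, I w /\ scale n%:R R (w - z)).
  exists (w :: l); split=> [y|x z']; first by rewrite inE => /predU1P[-> //|/lI].
  rewrite inE => /predU1P[-> Ix xz|Lz' Ix xz].
    exists w; first by rewrite inE eqxx.
    by rewrite (_ : x - w = (x - z) - (w - z)); [apply: idealB | ring].
  by have [y ly xy] := Hl x z' Lz' Ix xz; exists y; rewrite // inE ly orbT.
exists l; split=> // x z'; rewrite inE => /predU1P[-> Ix xz|]; last exact: Hl.
by case: nw; exists x.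
Qed.

Lemma pigeonhole n (g : nat -> K) : (0 < n)%N -> (forall k, R (g k)) ->
  exists k l, (k < l)%N /\ scale n%:R R (g l - g k).
Proof.
move=> n0 Rg; have nR : is_ideal (scale n%:R R).
  exact: scale_ideal (int_ring_nat _) int_ring_ideal.
have [L HL] := finite_quotient n0.
have /choice[h Hh] : forall k, exists i : 'I_(size L), scale n%:R R (g k - L`_i).
  move=> k; have [y Ly gy] := HL _ (Rg k).
  have lt : (index y L < size L)%N by rewrite index_mem.
  by exists (Ordinal lt); rewrite /= nth_index.
have : ~~ injectiveb (fun i : 'I_(size L).+1 => h i).
  by apply/injectiveP => /leq_card; rewrite !card_ord ltnn.
case/injectivePn => i [j ij hij].
have Hij : scale n%:R R (g j - g i).
  rewrite (_ : g j - g i = (g j - L`_(h j)) - (g i - L`_(h i))).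
    exact: idealB.
  by rewrite hij; ring.
have [lt|lt|/val_inj E] := ltngtP i j; last by rewrite E eqxx in ij.
- by exists i, j.
- by exists j, i; split=> //; rewrite -opprB; apply: idealN.
Qed.

(** The fractional ideal inverse to [I]. *)
Definition ideal_inv I : set K := [set x | forall y, I y -> R (x * y)].

Lemma ideal_inv1 I : is_ideal I -> ideal_inv I 1.
Proof. by move=> idI y Iy; rewrite mul1r; apply: ideal_sub Iy. Qed.

(** The element sought is [b / n], where [b] is killed by [I] modulo [n] but is
    not itself [0] modulo [n]. To find it by a finite induction over the
    generators of [I], the non-vanishing of [b] is strengthened to [S b]: [b]
    survives the localization at [1 + I]. The powers of a generator [x] repeat
    modulo [n], so [b x^k] cannot satisfy [S] for every [k]; just before
    the first failure, multiplying by a suitable [1 - i] kills the product with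
    [x] and preserves [S]. *)
Lemma proper_ideal_inv I n : is_ideal I -> (0 < n)%N -> I n%:R -> ~ I 1 ->
  exists2 x, ideal_inv I x & ~ R x.
Proof.
move=> idI n0 In I1.
have nR : is_ideal (scale n%:R R).
  exact: scale_ideal (int_ring_nat _) int_ring_ideal.
have R1 := int_ring1.
pose S b := forall i, I i -> ~ scale n%:R R ((1 - i) * b).
have S1 : S 1.
  move=> i Ii [z Rz Ez]; apply: I1; rewrite (_ : 1 = n%:R * z + i).
    by apply: idealD => //; apply: idealMr.
  by rewrite Ez; ring.
have Sl (l : seq K) : (forall y, y \in l -> I y) -> exists b, [/\ R b, S b &
    forall y, y \in l -> scale n%:R R (b * y)].
  elim: l => [|x l IH] lI; first by exists 1.
  have [y ly|b [Rb Sb bl]] := IH; first by apply: lI; rewrite inE ly orbT.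
  have Ix : I x by apply: lI; rewrite inE eqxx.
  have Rx : R x by exact: ideal_sub Ix.
  pose Q k := `[< ~ S (b * x ^+ k) >].
  have exQ : exists k, Q k.
    have Rg k : R (b * x ^+ k) by apply: int_ringM => //; apply: int_ringX.
    have [k [l' [kl H]]] := pigeonhole n0 Rg.
    (* [(1 - x^(l' - k)) b x^k] vanishes modulo [n]. *)
    exists k; apply/asboolP => /(_ (x ^+ (l' - k))); apply.
      rewrite -(prednK (n := (l' - k)%N)) ?subn_gt0 // exprS.
      by apply: idealMr => //; apply: int_ringX.
    rewrite (_ : _ * _ = - (b * x ^+ l' - b * x ^+ k)); first exact: idealN.
    by rewrite -{2}(subnK (ltnW kl)) exprD; ring.
  case: (ex_minnP exQ) => k /asboolP nSk mink.
  case: k nSk mink => [|k] nSk mink; first by rewrite expr0 mulr1 in nSk.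
  have Sk : S (b * x ^+ k).
    apply: contrapT => nS; have /mink : Q k by apply/asboolP.
    by rewrite ltnn.
  move/existsNP: nSk => [i /not_implyP[Ii /contrapT H]].
  have Ri : R (1 - i) by apply: int_ringB => //; apply: ideal_sub Ii.
  exists ((1 - i) * (b * x ^+ k)); split.
  - by apply: int_ringM => //; apply: int_ringM => //; apply: int_ringX.
  - move=> i' Ii'.
    rewrite mulrA (_ : (1 - i') * (1 - i) = 1 - (i + i' - i' * i)).
      apply: Sk; apply: idealB => //; first exact: idealD.
      by apply: idealMl => //; apply: ideal_sub Ii'.
    by ring.
  - move=> y; rewrite inE => /predU1P[->|/bl bly].
      by rewrite -mulrA -(mulrA b) -exprSr.
    rewrite (_ : _ * y = (1 - i) * x ^+ k * (b * y)); last by ring.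
    by apply: idealMl => //; apply: int_ringM => //; apply: int_ringX.
have [l [lI Hl]] := subset_representatives n0 (ideal_sub idI).
have [b [Rb Sb bl]] := Sl l lI.
have nn0 : (n%:R : K) != 0 by rewrite charK -lt0n.
exists (b / n%:R) => [y Iy|Rbn].
  have [y' ly' [z Rz Ez]] := Hl y Iy; have [t Rt Et] := bl y' ly'.
  have -> : b / n%:R * y = b * z + t.
    apply: (mulfI nn0); rewrite mulrDr Et (mulrCA _ b) Ez.
    by field.
  by apply: int_ringD => //; apply: int_ringM.
apply: (Sb 0 (ideal0 idI)); exists (b / n%:R) => //.
by field.
Qed.

(** Otherwise [I I^-1] is a proper ideal, so some non-integral [y] satisfies
    [y I I^-1 <= R], that is [y I^-1 <= I^-1]. Then [n y^k] is integral for all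
    [k], two of these elements agree modulo [n], and [y^l - y^k] is integral
    with [k < l]: this is a monic equation for [y], which is thus integral. *)
Lemma ideal_mul_inv I n : is_ideal I -> (0 < n)%N -> I n%:R ->
  ideal_mul I (ideal_inv I) 1.
Proof.
move=> idI n0 In; apply: contrapT => nI1.
have nn0 : (n%:R : K) != 0 by rewrite charK -lt0n.
have idJ : is_ideal (ideal_mul I (ideal_inv I)).
  by apply: ideal_mul_ideal => // x y Ix Iy; rewrite mulrC; apply: Iy.
have Jn : ideal_mul I (ideal_inv I) n%:R.
  by rewrite -[n%:R]mulr1; apply: ideal_mul_mem => //; apply: ideal_inv1.
have [y Hy nRy] := proper_ideal_inv idJ n0 Jn nI1; apply: nRy.
have yI z : ideal_inv I z -> ideal_inv I (y * z).
  by move=> Iz x Ix; rewrite -mulrA (mulrC z); apply/Hy/ideal_mul_mem.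
have yX k : ideal_inv I (y ^+ k).
  elim: k => [|k IH]; first exact: ideal_inv1.
  by rewrite exprS; apply: yI.
have Rg k : R (y ^+ k * n%:R) by apply: yX.
have [k [l [kl [r Rr Er]]]] := pigeonhole n0 Rg.
have {}Er : y ^+ l - y ^+ k = r by apply: (mulfI nn0); rewrite Er; ring.
have szl : (size ('X^k + r%:P : {poly K})%R < size ('X^l : {poly K})%R)%N.
  rewrite size_polyXn ltnS (leq_trans (size_polyD _ _)) // geq_max size_polyXn kl.
  by rewrite (leq_trans (size_polyC_leq1 _)) // (leq_trans _ kl).
apply: (@integral_root_monic _ _ _ _ ('X^l - ('X^k + r%:P))).
- by rewrite monicE lead_coefDl ?size_polyN // lead_coefXn.
- by rewrite /root !hornerE /= -Er; apply/eqP; ring.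
- apply/integral_poly => i; rewrite !coefE.
  apply: int_ringB; first exact: int_ring_nat.
  apply: int_ringD; first exact: int_ring_nat.
  by case: ifP => // _; apply: int_ring0.
Qed.

(** [(I^-1)^-1 <= I]: multiply an expression of [1] in [I I^-1] by [x]. *)
Lemma ideal_divisorial I n x : is_ideal I -> (0 < n)%N -> I n%:R ->
  (forall j, ideal_inv I j -> R (x * j)) -> I x.
Proof.
move=> idI n0 In Hx.
have [k [a [b [Ia Ib E]]]] := ideal_mul_inv idI n0 In.
rewrite -[x]mulr1 E mulr_sumr.
apply: (big_ind I) => [|u v|i _]; [exact: ideal0 | exact: idealD |].
by rewrite mulrCA; apply: idealMr => //; apply: Hx.
Qed.
End Integers.

(** * The congruence monoid and ideals coprime to the modulus *)

Section CongruenceMonoid.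
Variables (RR : realType) (K : fieldExtType rat) (m : modulus K RR).
Local Notation R := (@int_ring K).
Local Notation m0 := (modulus0 m).
Implicit Types (x y z a b : K) (I J : set K).

Lemma coset_eq I x y :
  is_ideal I -> I (x - y) -> Defs.coset x I = Defs.coset y I.
Proof.
move=> idI.
wlog suff H : x y / I (x - y) -> Defs.coset x I `<=` Defs.coset y I.
  move=> Ixy; apply/seteqP; split; apply: H => //.
  by rewrite -opprB; apply: idealN.
move=> Ixy _ [z Iz <-]; exists (x - y + z); first exact: idealD.
by rewrite addrA subrKC.
Qed.

Lemma coset_self I x : is_ideal I -> Defs.coset x I x.
Proof. by move=> idI; exists 0; [exact: ideal0 | rewrite addr0]. Qed.

Lemma cosetM I a b : is_ideal I -> R a -> R b ->
  [set z | exists x y c,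
    [/\ Defs.coset a I x, Defs.coset b I y, I c & z = x * y + c]]
  = Defs.coset (a * b) I.
Proof.
move=> idI Ra Rb; apply/seteqP; split=> z.
- move=> [_ [_ [c [[x Ix <-] [y Iy <-] Ic ->]]]].
  exists (a * y + x * b + x * y + c); last by ring.
  have IR := ideal_sub idI.
  apply: (idealD idI) Ic; apply: (idealD idI).
    by apply: (idealD idI); [apply: (idealMl idI) | apply: (idealMr idI)].
  by apply: (idealMl idI) => //; apply: IR.
- by move=> [c Ic <-]; exists a, b, c; split=> //; apply: coset_self.
Qed.

Lemma nonzero_element I :
  is_ideal I -> I <> [set 0] -> exists2 x, I x & x != 0.
Proof.
move=> idI In0; apply: contrapT => H; apply: In0; apply/seteqP; split=> x.
- move=> Ix; apply/eqP; apply: contrapT => /negP x0.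
  by apply: H; exists x.
- by move=> ->; apply: ideal0.
Qed.

Lemma ideal_mul_nonzero I J : is_ideal I -> is_ideal J ->
  (exists2 x, I x & x != 0) -> (exists2 x, J x & x != 0) ->
  is_ideal (ideal_mul I J) /\ exists2 x, ideal_mul I J x & x != 0.
Proof.
move=> idI idJ [x Ix x0] [y Jy y0]; split.
  apply: ideal_mul_ideal => // u v Iu Jv.
  by apply: int_ringM; [apply: ideal_sub Iu | apply: ideal_sub Jv].
by exists (x * y); [exact: ideal_mul_mem | rewrite mulf_neq0].
Qed.

Lemma ideal_exp_nonzero (p : nzprime K) n :
  is_ideal (ideal_exp (val p) n) /\ exists2 x, ideal_exp (val p) n x & x != 0.
Proof.
have pp : is_nzprime (val p) by have /asboolP := valP p.
elim: n => [|n [idn nzn]].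
  split; first exact: int_ring_ideal.
  by exists 1; [exact: int_ring1 | exact: oner_neq0].
apply: ideal_mul_nonzero => //; first exact: nzprime_ideal.
by apply: nonzero_element; [exact: nzprime_ideal | exact: nzprime_nz].
Qed.

Lemma modulus0_nonzero : is_ideal m0 /\ exists2 x, m0 x & x != 0.
Proof.
apply: (big_ind (fun I => is_ideal I /\ exists2 x, I x & x != 0)).
- split; first exact: int_ring_ideal.
  by exists 1; [exact: int_ring1 | exact: oner_neq0].
- by move=> I J [? ?] [? ?]; apply: ideal_mul_nonzero.
- by move=> p _; apply: ideal_exp_nonzero.
Qed.

Lemma modulus0_ideal : is_ideal m0. Proof. by case: modulus0_nonzero. Qed.
Local Notation idm := modulus0_ideal.

Lemma modulus0_nat : exists2 n, (0 < n)%N & m0 n%:R.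
Proof.
by have [idm0 [x mx x0]] := modulus0_nonzero; apply: nat_in_ideal mx x0.
Qed.

(** The class of [y] modulo [n] contains [y + n (1 + y^2)], which is positive at
    all real places at once, since [1 + t + t^2 > 0] and [n >= 1]. If this
    element happens to vanish, adding [n] repairs it. *)
Lemma positive_representative n y : (0 < n)%N -> R y ->
  exists z, [/\ R z, y + n%:R * z != 0 &
    forall w : {rmorphism K -> RR}, 0 < w (y + n%:R * z)].
Proof.
move=> n0 Ry.
have Rz : R (1 + y ^+ 2) by apply: int_ringD (int_ring1 _) (int_ringX _ Ry).
have [E|ne] := eqVneq (y + n%:R * (1 + y ^+ 2)) 0.
  exists (1 + y ^+ 2 + 1); split=> [||w].
  - exact: int_ringD Rz (int_ring1 _).
  - by rewrite mulrDr addrA E add0r mulr1 charK -lt0n.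
  - by rewrite mulrDr addrA E add0r mulr1 rmorph_nat ltr0n.
exists (1 + y ^+ 2); split=> // w.
rewrite rmorphD rmorphM rmorphD rmorphXn rmorph_nat rmorph1 /=.
have : (1 : RR) <= n%:R by rewrite ler1n.
set t := w y; set N : RR := n%:R => N1.
have : 0 <= (N - 1) * (1 + t ^+ 2).
  by rewrite mulr_ge0 ?subr_ge0 // addr_ge0 ?ler01 ?sqr_ge0.
have : 0 <= (t + 1) ^+ 2 by rewrite sqr_ge0.
have : 0 <= t ^+ 2 by rewrite sqr_ge0.
by nra.
Qed.

(** A prime dividing [m0] and containing the unit [a] would contain [1]. *)
Lemma unit_int_coprime a b : R a -> a != 0 -> R b -> m0 (a * b - 1) ->
  int_coprime m a.
Proof.
move=> Ra a0 Rb mab; split=> // p [L idL E].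
have pp : is_nzprime (val p) by have /asboolP := valP p.
have idp := nzprime_ideal pp.
split=> //= pa; apply: (nzprime_proper pp); apply: ideal_eq_int_ring => //.
rewrite (_ : 1 = a * b - (a * b - 1)); last by ring.
apply: idealB => //; first by apply: idealMr => //; apply: ideal_mul_subl pa.
by move: mab; rewrite E; apply: ideal_mul_subl => //; apply: ideal_sub.
Qed.

Variables (Gamma : set (residue m)) (hG : residue_subgroup Gamma).
Local Notation C := (congruence_monoid Gamma).

Lemma congruence_monoid_int a : C a -> R a. Proof. by case=> [[]]. Qed.
Lemma congruence_monoid_neq0 a : C a -> a != 0. Proof. by case=> [[]]. Qed.

Lemma congruence_monoid_unit a : C a -> exists2 b, R b & m0 (a * b - 1).
Proof.
move=> [_ /(rsub_units hG) [_ [a' [b [Ra' Rb /= E mab]]]]].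
have : Defs.coset a' m0 a by rewrite -E; apply: coset_self idm.
move=> [c mc <-]; exists b => //.
rewrite (_ : _ - 1 = (a' * b - 1) + c * b); last by ring.
by apply: (idealD idm) => //; apply: (idealMr idm).
Qed.

(** The class of [a] modulo [m] is trivial, so it belongs to every subgroup. *)
Lemma positive_congruence_monoid a : R a -> a != 0 -> m0 (a - 1) ->
  (forall w : {rmorphism K -> RR}, 0 < w a) -> C a.
Proof.
move=> Ra a0 ma wa; split.
  by apply: (unit_int_coprime (b := 1)) => //; [exact: int_ring1 | rewrite mulr1].
suff -> : residue_class m a = residue1 m by apply: rsub_one.
congr pair; last exact: coset_eq idm ma.
by apply/funext => w; apply: gtr0_sgz.
Qed.

Lemma congruence_monoid1 : C 1.
Proof.
apply: positive_congruence_monoid; [exact: int_ring1 | exact: oner_neq0 | |].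
- by rewrite subrr; apply: ideal0 idm.
- by move=> w; rewrite rmorph1 ltr01.
Qed.

Lemma residue_classM a b : R a -> R b ->
  residueM (residue_class m a) (residue_class m b) = residue_class m (a * b).
Proof.
move=> Ra Rb; congr pair; last exact: cosetM idm Ra Rb.
by apply/funext => w; rewrite /= rmorphM sgzM.
Qed.

Lemma congruence_monoidM a b : C a -> C b -> C (a * b).
Proof.
move=> Ca Cb.
have [Ra Rb] := (congruence_monoid_int Ca, congruence_monoid_int Cb).
have [a' Ra' maa'] := congruence_monoid_unit Ca.
have [b' Rb' mbb'] := congruence_monoid_unit Cb.
split; last first.
  rewrite -residue_classM //.
  by apply: rsub_mul => //; [case: Ca | case: Cb].
apply: (unit_int_coprime (b := a' * b')); try exact: int_ringM.
  by rewrite mulf_neq0 ?congruence_monoid_neq0.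
rewrite (_ : _ - 1 = (a * a' - 1) * (b * b') + (b * b' - 1)); last by ring.
by apply: (idealD idm) => //; apply: (idealMr idm) => //; apply: int_ringM.
Qed.

(** The residue [y] made of the signs of [a] and an inverse of [a] modulo [m0] is
    the inverse of the class of [a], and [y] times the class of [a b] is the
    class of [b]. *)
Lemma congruence_monoid_cancel a b : C a -> R b -> C (a * b) -> C b.
Proof.
move=> Ca Rb Cab.
have [Ra Rab] := (congruence_monoid_int Ca, congruence_monoid_int Cab).
have [a' Ra' maa'] := congruence_monoid_unit Ca.
have [c Rc mc] := congruence_monoid_unit Cab.
split.
  apply: (unit_int_coprime (b := a * c)) => //; last first.
    by rewrite mulrA (mulrC b).
  - exact: int_ringM.
  - by have := congruence_monoid_neq0 Cab; rewrite mulf_eq0 negb_or => /andP[].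
pose y : residue m := ((residue_class m a).1, Defs.coset a' m0).
have sgn2 (w : {rmorphism K -> RR}) : sgz (w a) * sgz (w a) = 1.
  rewrite -sgzM -expr2; apply: gtr0_sgz.
  by rewrite exprn_even_gt0 //= fmorph_eq0 congruence_monoid_neq0.
have uy : residue_units y.
  split=> /= [w|]; last by exists a', a; split=> //; rewrite mulrC.
  have : val w a != 0 by rewrite fmorph_eq0 congruence_monoid_neq0.
  rewrite neq_lt => /orP[/ltr0_sgz ->|/gtr0_sgz ->]; by [right | left].
have Gy : Gamma y.
  have Ga : Gamma (residue_class m a) by case: Ca.
  apply: (rsub_inv hG Ga uy); congr pair.
    by apply/funext => w; apply: sgn2.
  rewrite (cosetM idm) //; exact: coset_eq idm maa'.
suff -> : residue_class m b = residueM y (residue_class m (a * b)).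
  by apply: rsub_mul => //; case: Cab.
congr pair.
  by apply/funext => w; rewrite /= rmorphM sgzM mulrA sgn2 mul1r.
rewrite /= (cosetM idm) //; apply: (coset_eq idm).
rewrite (_ : _ - _ = - ((a * a' - 1) * b)); last by ring.
by apply: (idealN idm); apply: (idealMr idm).
Qed.

(** An element of [I] congruent to [1] modulo [m0] is moved inside its class
    modulo an integer of [I] and [m0] until it is positive. *)
Lemma coprime_element I : ideals_coprime m I ->
  exists t, [/\ I t, C t & m0 (t - 1)].
Proof.
move=> [idI In0 IR].
have [i Ii [u mu iu]] : [set x + y | x in I & y in m0] 1.
  by rewrite (IR : _ = _); apply: int_ring1.
have [x Ix x0] := nonzero_element idI In0.
have [n1 n1_gt0 In1] := nat_in_ideal idI Ix x0.
have [n2 n2_gt0 mn2] := modulus0_nat.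
have n0 : (0 < n1 * n2)%N by rewrite muln_gt0 n1_gt0.
have [z [Rz t0 tp]] := positive_representative n0 (ideal_sub idI Ii).
have In : I (i + (n1 * n2)%:R * z).
  apply: idealD => //; apply: idealMr => //.
  by rewrite natrM; apply: idealMr => //; apply: int_ring_nat.
have mt : m0 (i + (n1 * n2)%:R * z - 1).
  rewrite (_ : _ - 1 = (n1 * n2)%:R * z - u); last by rewrite -iu; ring.
  apply: (idealB idm) => //; apply: (idealMr idm) => //.
  by rewrite natrM; apply: (idealMl idm) => //; apply: int_ring_nat.
exists (i + (n1 * n2)%:R * z); split=> //.
by apply: positive_congruence_monoid => //; apply: ideal_sub In.
Qed.

(** Converse of [coprime_element]: coprimality to [m0] is witnessed by an element
    of [I] in the congruence monoid. The closure properties of the monoid of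
    coprime ideals all follow by exhibiting such an element. *)
Lemma ideals_coprimeI I t : is_ideal I -> I t -> C t -> ideals_coprime m I.
Proof.
move=> idI It Ct; have [b Rb mtb] := congruence_monoid_unit Ct.
split=> // [E|].
  by move: It (congruence_monoid_neq0 Ct); rewrite E => ->; rewrite eqxx.
apply/seteqP; split=> [_ [x Ix [y my <-]]|x Rx].
  by apply: int_ringD; [apply: ideal_sub Ix | apply: (ideal_sub idm)].
exists (t * (b * x)); first by apply: idealMr => //; apply: int_ringM.
exists (- ((t * b - 1) * x)); last by ring.
by apply: (idealN idm); apply: (idealMr idm).
Qed.

Lemma ideals_coprime_int_ring : ideals_coprime m R.
Proof.
exact: ideals_coprimeI (int_ring_ideal K) (int_ring1 K) congruence_monoid1.
Qed.

Lemma ideals_coprime_cap I J :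
  ideals_coprime m I -> ideals_coprime m J -> ideals_coprime m (I `&` J).
Proof.
move=> cI cJ; have [[idI _ _] [idJ _ _]] := (cI, cJ).
have [[t [It Ct _]] [s [Js Cs _]]] := (coprime_element cI, coprime_element cJ).
apply: (ideals_coprimeI (t := t * s)); last exact: congruence_monoidM.
- split=> [x [/(ideal_sub idI)] //||x y [? ?] [? ?]|a x Ra [? ?]].
  + by split; apply: ideal0.
  + by split; apply: idealD.
  + by split; apply: idealMl.
- split; first by apply: idealMr => //; apply: congruence_monoid_int.
  by apply: idealMl => //; apply: congruence_monoid_int.
Qed.

Lemma ideals_coprime_scale a I :
  C a -> ideals_coprime m I -> ideals_coprime m (scale a I).
Proof.
move=> Ca cI; have [idI _ _] := cI; have [t [It Ct _]] := coprime_element cI.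
apply: (ideals_coprimeI (t := a * t)); last exact: congruence_monoidM.
- by apply: scale_ideal => //; apply: congruence_monoid_int.
- by exists t.
Qed.

Definition ideal_preimage a I : set K := [set x | R x /\ I (a * x)].

Lemma ideals_coprime_preimage a I :
  C a -> ideals_coprime m I -> ideals_coprime m (ideal_preimage a I).
Proof.
move=> Ca cI; have [idI _ _] := cI; have [t [It Ct _]] := coprime_element cI.
have Ra := congruence_monoid_int Ca.
apply: (ideals_coprimeI (t := t)) => //.
- split=> [x []//||x y [Rx Ix] [Ry Iy]|b x Rb [Rx Ix]].
  + by split; [exact: int_ring0 | rewrite mulr0; apply: ideal0].
  + by split; [exact: int_ringD | rewrite mulrDr; apply: idealD].
  + by split; [exact: int_ringM | rewrite mulrCA; apply: idealMl].
- by split; [apply: congruence_monoid_int | apply: idealMl].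
Qed.

Definition ideal_add I J : set K := [set x + y | x in I & y in J].

Lemma ideals_coprime_add I J :
  ideals_coprime m I -> is_ideal J -> ideals_coprime m (ideal_add I J).
Proof.
move=> cI idJ; have [idI _ _] := cI; have [t [It Ct _]] := coprime_element cI.
apply: (ideals_coprimeI (t := t)) => //; last first.
  by exists t => //; exists 0; [exact: ideal0 | rewrite addr0].
split.
- move=> _ [x Ix [y Jy <-]].
  by apply: int_ringD; [apply: ideal_sub Ix | apply: ideal_sub Jy].
- by exists 0; [exact: ideal0|exists 0; [exact: ideal0|rewrite addr0]].
- move=> _ _ [x Ix [y Jy <-]] [x' Ix' [y' Jy' <-]].
  exists (x + x'); first exact: idealD.
  by exists (y + y'); [exact: idealD | rewrite addrACA].
- move=> a _ Ra [x Ix [y Jy <-]].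
  exists (a * x); first exact: idealMl.
  by exists (a * y); [exact: idealMl | rewrite mulrDr].
Qed.

Lemma scale_congruence_monoid a I : C a -> I `<=` R ->
  scale a I `&` C = scale a (I `&` C).
Proof.
move=> Ca IR; apply/seteqP; split=> [_ [[x Ix <-] Cax]|_ [x [Ix Cx] <-]].
  exists x => //; split=> //.
  by apply: congruence_monoid_cancel Cax => //; apply: IR.
by split; [exists x | apply: congruence_monoidM].
Qed.

(** A coprime ideal is a finite intersection of ideals [b^-1 (a R)] with [a], [b]
    in the congruence monoid. Let [a] be in [I] and [J = a I^-1]. By
    divisoriality [I] is the set of [x] with [x J <= a R], and it is enough to
    test generators [j] of [J] modulo [a]. Each [j] is replaced by
    [j (1 - a) + a + n z], with [a = 1] modulo [m0] and [n] in [a R] and [m0]: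
    this is congruent to [1] modulo [m0], it is positive for a suitable [z], and
    modulo [a R] its product with [x] vanishes exactly when [j x] does. *)
Lemma coprime_ideal_quotients I : ideals_coprime m I ->
  exists a (l : seq K), [/\ C a, (forall b, b \in l -> C b) &
    forall x, R x -> (I x <-> forall b, b \in l -> scale a R (b * x))].
Proof.
move=> cI; have [idI _ _] := cI.
have [a [Ia Ca ma]] := coprime_element cI.
have [Ra a0] := (congruence_monoid_int Ca, congruence_monoid_neq0 Ca).
have idA : is_ideal (scale a R) := scale_ideal Ra (int_ring_ideal K).
have Aa x : R x -> scale a R (a * x) by exists x.
have AI : scale a R `<=` I by move=> _ [x Rx <-]; apply: idealMr.
have [|n1 n1_gt0 An1] := nat_in_ideal idA _ a0.
  by exists 1; [exact: int_ring1 | rewrite mulr1].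
have [n2 n2_gt0 mn2] := modulus0_nat.
pose n := (n1 * n2)%N.
have n0 : (0 < n)%N by rewrite muln_gt0 n1_gt0.
have An : scale a R n%:R.
  by rewrite natrM; apply: (idealMr idA) => //; apply: int_ring_nat.
have mn : m0 n%:R.
  by rewrite natrM; apply: (idealMl idm) => //; apply: int_ring_nat.
pose J : set K := [set j | forall y, I y -> scale a R (j * y)].
have JR : J `<=` R.
  by move=> j /(_ a Ia) [x Rx]; rewrite (mulrC j) => /(mulfI a0) <-.
have [l0 [l0J Hl0]] := subset_representatives n0 JR.
have /choice[z Hz] : forall j, exists z, R j ->
    [/\ R z, j * (1 - a) + a + n%:R * z != 0 &
        forall w : {rmorphism K -> RR}, 0 < w (j * (1 - a) + a + n%:R * z)].
  move=> j; have [Rj|] := pselect (R j); last by exists 0.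
  have [|z Hz] := @positive_representative n (j * (1 - a) + a) n0.
    apply: int_ringD => //; apply: int_ringM => //.
    exact: int_ringB (int_ring1 _) _.
  by exists z.
pose b j := j * (1 - a) + a + n%:R * z j.
exists a, [seq b j | j <- l0]; split=> //.
  move=> _ /mapP[j /l0J/JR Rj ->]; have [Rz b0 bpos] := Hz j Rj.
  have Rb : R (b j).
    apply: int_ringD; last by apply: int_ringM => //; apply: int_ring_nat.
    apply: int_ringD => //; apply: int_ringM => //.
    exact: int_ringB (int_ring1 _) _.
  apply: positive_congruence_monoid => //.
  rewrite /b (_ : _ - 1 = (1 - j) * (a - 1) + n%:R * z j); last by ring.
  apply: (idealD idm); last exact: (idealMr idm).
  by apply: (idealMl idm) => //; apply: int_ringB (int_ring1 _) _.
move=> x Rx; split=> [Ix _ /mapP[j lj ->]|H].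
  have Rj := JR _ (l0J _ lj); have [Rz _ _] := Hz j Rj.
  rewrite /b (_ : _ * x = (1 - a) * (j * x) + a * x + n%:R * (z j * x));
    last by ring.
  apply: (idealD idA); last by apply: (idealMr idA) => //; apply: int_ringM.
  apply: (idealD idA); last exact: Aa.
  apply: (idealMl idA); first exact: int_ringB (int_ring1 _) _.
  exact: l0J Ix.
have Hl j : j \in l0 -> scale a R (j * x).
  move=> lj; have Rj := JR _ (l0J _ lj); have [Rz _ _] := Hz j Rj.
  rewrite (_ : j * x = b j * x + a * ((j - 1) * x) - n%:R * (z j * x));
    last by rewrite /b; ring.
  apply: (idealB idA); last by apply: (idealMr idA) => //; apply: int_ringM.
  apply: (idealD idA); first by apply: H; apply: map_f.
  by apply: Aa; apply: int_ringM => //; apply: int_ringB _ (int_ring1 _).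
(* Every element of [J] is a multiple [a k] with [k] in the inverse of [I]. *)
apply: (ideal_divisorial idI n0 (AI _ An)) => k Ik.
have Jk : J (a * k) by move=> y Iy; rewrite -mulrA; apply/Aa/Ik.
have [j lj [r Rr Er]] := Hl0 _ Jk.
have [s Rs Es] : scale a R (a * k * x).
  rewrite (_ : a * k * x = j * x + (a * k - j) * x); last by ring.
  apply: (idealD idA); first exact: Hl.
  rewrite -Er -mulrA; apply: (idealMr idA) => //; exact: int_ringM.
by rewrite (_ : x * k = s) //; apply: (mulfI a0); rewrite Es; ring.
Qed.

End CongruenceMonoid.

(** * Constructible right ideals *)

Section AffineGroupLemmas.
Variable K : fieldType.
Implicit Types (p g : affine K) (a b c d : K).

Lemma val_mulg p g : val (p * g)%g =
  ((val p).1 + (val p).2 * (val g).1, (val p).2 * (val g).2).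
Proof. exact: val_affineM. Qed.

Lemma affM b a d c : a != 0 -> c != 0 ->
  (aff b a * aff d c)%g = aff (b + a * d) (a * c).
Proof.
by move=> a0 c0; apply: val_inj; rewrite val_mulg !val_aff ?mulf_neq0.
Qed.

Lemma aff_val g : aff (val g).1 (val g).2 = g.
Proof. by apply: val_inj; rewrite val_aff ?(valP g) //; case: (val g). Qed.

Lemma aff01 : aff 0 1 = 1%g :> affine K.
Proof. by apply: val_inj; rewrite val_aff ?oner_neq0. Qed.

Lemma aff_split b a : a != 0 -> aff b a = (aff b 1 * aff 0 a)%g.
Proof. by move=> a0; rewrite affM ?oner_neq0 // mulr0 addr0 mul1r. Qed.

Lemma aff_commute a x : a != 0 ->
  (aff 0 a * aff x 1)%g = (aff (a * x) 1 * aff 0 a)%g.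
Proof.
by move=> a0; rewrite !affM ?oner_neq0 // mulr0 addr0 add0r mul1r mulr1.
Qed.
End AffineGroupLemmas.

Lemma lpreimageE (G : groupType) (P : set G) (p : G) (X : set G) :
  lpreimage P p X = [set g | P g /\ X (p * g)%g].
Proof.
apply/seteqP; split=> [g [[x Xx <-] Pg]|g [Pg Xg]].
  by split; rewrite ?mulKVg.
by split=> //; exists (p * g)%g; rewrite ?mulKg.
Qed.

Section ConstructibleIdeals.
Variables (RR : realType) (K : fieldExtType rat) (m : modulus K RR).
Variables (Gamma : set (residue m)) (hG : residue_subgroup Gamma).
Local Notation R := (@int_ring K).
Local Notation C := (congruence_monoid Gamma).
Local Notation P := (affine_semigroup Gamma).
Implicit Types (x y z a b : K) (I J : set K) (X : set (affine K)).

Definition affine_coset x I : set (affine K) :=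
  [set g | I ((val g).1 - x) /\ (I `&` C) (val g).2].

Lemma affine_coset0 I : affine_coset 0 I = affine_ideal Gamma I.
Proof.
by apply/seteqP; split=> g []; rewrite ?subr0 => ? ?; split; rewrite ?subr0.
Qed.

Lemma affine_ideal_int_ring : affine_ideal Gamma R = P.
Proof.
apply/seteqP; split=> g; first by move=> [? []].
by move=> [? Cg]; split=> //; split=> //; apply: congruence_monoid_int Cg.
Qed.

Lemma affine_semigroupE x a : a != 0 -> P (aff x a) <-> R x /\ C a.
Proof. by move=> a0; rewrite /affine_semigroup /= val_aff. Qed.

Lemma ltranslate_affine_coset p x I : P p -> ideals_coprime m I ->
  ltranslate p (affine_coset x I)
  = affine_coset ((val p).1 + (val p).2 * x) (scale (val p).2 I).
Proof.
move=> [Rp Cp] [idI _ _]; set a := (val p).2 in Cp *; set b := (val p).1.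
have a0 : a != 0 := congruence_monoid_neq0 Cp.
have Ea := scale_congruence_monoid hG Cp (ideal_sub idI).
apply/seteqP; split.
- move=> _ [g [Ig Cg] <-]; rewrite /affine_coset /= val_mulg -/a -/b /=.
  split; last first.
    suff : (scale a I `&` C) (a * (val g).2) by [].
    by rewrite Ea; exists (val g).2.
  by exists ((val g).1 - x) => //; ring.
- move=> h [[i Ii Ei] Sh].
  have [c Ic Ec] : scale a (I `&` C) (val h).2 by rewrite -Ea.
  have Eph : (p * (p^-1 * h))%g = h by rewrite mulKVg.
  exists (p^-1 * h)%g => //; move: (congr1 val Eph); rewrite val_mulg -/a -/b.
  set g := (p^-1 * h)%g => E; move: Ei Ec; rewrite -E /= => Ei Ec; split.
    rewrite (_ : _ - x = i) //; apply: (mulfI a0); rewrite Ei; ring.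
  by rewrite (_ : (val g).2 = c) //; apply: (mulfI a0).
Qed.

Lemma lpreimage_affine_coset p x I : P p -> ideals_coprime m I ->
  lpreimage P p (affine_coset x I) = set0 \/
  exists2 y, R y & lpreimage P p (affine_coset x I)
                   = affine_coset y (ideal_preimage (val p).2 I).
Proof.
move=> [Rp Cp] cI; have [idI _ _] := cI.
rewrite lpreimageE; set a := (val p).2 in Cp *.
have [[g0 [[Rg0 _] [Ig0 _]]]|n0] :=
    pselect (exists g0, P g0 /\ affine_coset x I (p * g0)%g); last first.
  by left; apply/seteqP; split=> // g Pg; apply: n0; exists g.
right; exists (val g0).1 => //; move: Ig0; rewrite val_mulg /= => Ig0.
apply/seteqP; split=> g.
- move=> [[Rg Cg] [Ig [Iag _]]]; move: Ig Iag; rewrite val_mulg /= => Ig Iag.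
  split; last by split=> //; split=> //; apply: congruence_monoid_int Cg.
  split; first exact: int_ringB.
  rewrite (_ : _ * _ = ((val p).1 + a * (val g).1 - x)
                       - ((val p).1 + a * (val g0).1 - x)); last by ring.
  exact: idealB.
- move=> [[Rg Ig] [[_ Iag] Cg]].
  split.
    by split=> //; rewrite -[(val g).1](subrK (val g0).1); apply: int_ringD.
  rewrite /affine_coset /= val_mulg /=; split; last first.
    by split=> //; apply: congruence_monoidM.
  rewrite (_ : _ - x = a * ((val g).1 - (val g0).1)
                       + ((val p).1 + a * (val g0).1 - x));
    last by rewrite -/a; ring.
  exact: idealD.
Qed.

Lemma affine_coset_cap x y I J : R x -> is_ideal I -> is_ideal J ->
  affine_coset x I `&` affine_coset y J = set0 \/
  exists z, [/\ R z, I (z - x), J (z - y)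
    & affine_coset x I `&` affine_coset y J = affine_coset z (I `&` J)].
Proof.
move=> Rx idI idJ.
have [[g0 [[Ig0 _] [Jg0 _]]]|n0] :=
    pselect (exists g0, (affine_coset x I `&` affine_coset y J) g0); last first.
  by left; apply/seteqP; split=> // g Pg; apply: n0; exists g.
right; exists (val g0).1; split=> //.
  rewrite -[(val g0).1](subrK x).
  by apply: int_ringD => //; apply: ideal_sub Ig0.
have E (u : K) v w : u - w = (u - v) + (v - w) by ring.
have E' (u : K) v w : u - v = (u - w) - (v - w) by ring.
apply/seteqP; split=> g.
- move=> [[Ig [Ig2 Cg]] [Jg [Jg2 _]]]; split=> //.
  by split; [rewrite (E' _ _ x) | rewrite (E' _ _ y)]; apply: idealB.
- move=> [[Ig Jg] [[Ig2 Jg2] Cg]].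
  by split; split=> //; rewrite (E _ (val g0).1); apply: idealD.
Qed.

(** Each closure operation defining the constructible ideals preserves sets of
    this form, as the congruence monoid is closed under products and
    cancellation. *)
Lemma constructible_affine_coset X : constructible P X ->
  X = set0 \/ exists x I, [/\ R x, ideals_coprime m I & X = affine_coset x I].
Proof.
elim=> {X} [||p X Pp _ [->|[x [I [Rx cI ->]]]]
             |p X Pp _ [->|[x [I [Rx cI ->]]]]
             |X Y _ [->|[x [I [Rx cI ->]]]] _ [->|[y [J [Ry cJ ->]]]]].
- by left.
- right; exists 0, R; split.
  + exact: int_ring0.
  + exact: (ideals_coprime_int_ring hG).
  + by rewrite affine_coset0 affine_ideal_int_ring.
- by left; rewrite /ltranslate image_set0.
- right; exists ((val p).1 + (val p).2 * x), (scale (val p).2 I).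
  have [Rp Cp] := Pp; split; last exact: ltranslate_affine_coset.
  + apply: int_ringD => //; apply: int_ringM => //.
    exact: congruence_monoid_int Cp.
  + exact: (ideals_coprime_scale hG).
- by left; rewrite /lpreimage image_set0 set0I.
- have [->|[y Ry ->]] := lpreimage_affine_coset x Pp cI; [by left | right].
  exists y, (ideal_preimage (val p).2 I); split=> //.
  by apply: (ideals_coprime_preimage hG) => //; case: Pp.
- by left; rewrite set0I.
- by left; rewrite set0I.
- by left; rewrite setI0.
- have [[idI _ _] [idJ _ _]] := (cI, cJ).
  have [->|[z [Rz _ _ ->]]] := affine_coset_cap y Rx idI idJ; [by left | right].
  by exists z, (I `&` J); split=> //; apply: (ideals_coprime_cap hG).
Qed.

(** The set is cut out of the semigroup by the conditions [(0, b) g] in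
    [(0, a) P], for the [a] and [b] of [coprime_ideal_quotients]. *)
Lemma constructible_affine_ideal I :
  ideals_coprime m I -> constructible P (affine_ideal Gamma I).
Proof.
move=> cI; have [idI _ _] := cI.
have [a [l [Ca Cl Hl]]] := coprime_ideal_quotients hG cI.
have a0 := congruence_monoid_neq0 Ca.
have Pa : P (aff 0 a).
  by apply/affine_semigroupE => //; split=> //; apply: int_ring0.
pose Y := ltranslate (aff 0 a) P.
have EY : Y = affine_coset 0 (scale a R).
  rewrite /Y -affine_ideal_int_ring -affine_coset0 ltranslate_affine_coset //.
    by rewrite val_aff //= mulr0 addr0.
  exact: (ideals_coprime_int_ring hG).
have -> : affine_ideal Gamma I =
    [set g | P g /\ forall b, b \in l -> Y (aff 0 b * g)%g].
  rewrite EY -affine_coset0; apply/seteqP; split=> g.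
  - move=> [Ig [Ig2 Cg]]; rewrite subr0 in Ig.
    have Rg := ideal_sub idI Ig; split=> // b lb.
    have b0 := congruence_monoid_neq0 (Cl b lb).
    rewrite /affine_coset /= val_mulg val_aff //= add0r subr0.
    split; first by move: b lb {b0}; apply/Hl.
    split; last by apply: congruence_monoidM => //; apply: Cl.
    by move: b lb {b0}; apply/Hl => //; apply: congruence_monoid_int Cg.
  - move=> [[Rg Cg] Hg]; rewrite /affine_coset /= subr0.
    have Rg2 := congruence_monoid_int Cg.
    have Hg' b : b \in l ->
        scale a R (b * (val g).1) /\ scale a R (b * (val g).2).
      move=> lb; have b0 := congruence_monoid_neq0 (Cl b lb).
      have := Hg b lb; rewrite /affine_coset /= val_mulg val_aff //= add0r subr0.
      by move=> [? []].
    by split; last split=> //; apply/Hl => // b /Hg'[].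
elim: l Cl {Hl} => [|b l IH] Cl.
  rewrite (_ : [set g | _] = P); first exact: constructibleT.
  by apply/seteqP; split=> g; [case | split].
have Cb : C b by apply: Cl; rewrite inE eqxx.
rewrite (_ : [set g | _] = lpreimage P (aff 0 b) Y `&`
    [set g | P g /\ forall b, b \in l -> Y (aff 0 b * g)%g]).
  apply: constructibleI; last first.
    by apply: IH => c lc; apply: Cl; rewrite inE lc orbT.
  apply: constructibleV.
    apply/(affine_semigroupE 0 (congruence_monoid_neq0 Cb)).
    by split=> //; apply: int_ring0.
  by apply: constructibleM => //; apply: constructibleT.
rewrite lpreimageE; apply/seteqP; split=> g.
- move=> [Pg H]; split; first by split=> //; apply: H; rewrite inE eqxx.
  by split=> // c lc; apply: H; rewrite inE lc orbT.
- by move=> [[Pg Hb] [_ H]]; split=> // c; rewrite inE => /predU1P[->|/H].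
Qed.

Lemma ltranslate_affine_ideal x I : R x -> ideals_coprime m I ->
  ltranslate (aff x 1) (affine_ideal Gamma I) = affine_coset x I.
Proof.
move=> Rx cI; rewrite -affine_coset0 ltranslate_affine_coset //; last first.
  apply/(affine_semigroupE _ (oner_neq0 K)); split=> //.
  exact: congruence_monoid1.
rewrite val_aff ?oner_neq0 //= mulr0 addr0; congr affine_coset.
apply/seteqP; split=> [_ [y Iy <-]|y Iy]; first by rewrite mul1r.
by exists y; rewrite ?mul1r.
Qed.

Lemma affine_coset_point x I z t :
  I (z - x) -> I t -> C t -> affine_coset x I (aff z t).
Proof.
move=> Iz It Ct.
by rewrite /affine_coset /= val_aff // (congruence_monoid_neq0 Ct).
Qed.

(** The coset and the ideal can be read off because the second factor is not
    empty. *)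
Lemma affine_coset_inj x y I J :
  ideals_coprime m I -> ideals_coprime m J ->
  affine_coset x I = affine_coset y J -> I = J /\ I (x - y).
Proof.
wlog suff H : x y I J / ideals_coprime m I -> ideals_coprime m J ->
    affine_coset x I = affine_coset y J -> I `<=` J /\ J (x - y).
  move=> cI cJ E; have [IJ Jxy] := H _ _ _ _ cI cJ E.
  have [JI _] := H _ _ _ _ cJ cI (esym E).
  by split; [apply/seteqP; split | apply: JI].
move=> cI [idJ _ _] E; have [idI _ _] := cI.
have [t [It Ct _]] := coprime_element hG cI.
have Ji i : I i -> J (x + i - y).
  move=> Ii; have : affine_coset x I (aff (x + i) t).
    by apply: affine_coset_point => //; rewrite addrAC subrr add0r.
  rewrite E => -[+ _]; by rewrite val_aff // (congruence_monoid_neq0 Ct).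
have Jxy : J (x - y) by have := Ji 0 (ideal0 idI); rewrite addr0.
split=> // i /Ji Jx.
by rewrite (_ : i = (x + i - y) - (x - y)); [apply: idealB | ring].
Qed.

Lemma affine_coset_nonempty x I : ideals_coprime m I -> affine_coset x I <> set0.
Proof.
move=> cI E; have [t [It Ct _]] := coprime_element hG cI; have [idI _ _] := cI.
suff : affine_coset x I (aff x t) by rewrite E.
by apply: affine_coset_point => //; rewrite subrr; apply: ideal0.
Qed.

(** As [I] and [J] share an element of the congruence monoid, only the cosets
    [x + I] and [y + J] can be responsible for an empty intersection. *)
Lemma affine_coset_disjoint x y I J :
  ideals_coprime m I -> ideals_coprime m J ->
  affine_coset x I `&` affine_coset y J = set0 -> ~ ideal_add I J (y - x).
Proof.
move=> cI cJ E [i Ii [j Jj ij]]; have [idJ _ _] := cJ.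
have [t [[It Jt] Ct _]] := coprime_element hG (ideals_coprime_cap hG cI cJ).
suff : (affine_coset x I `&` affine_coset y J) (aff (x + i) t) by rewrite E.
split; apply: affine_coset_point => //.
  by rewrite (_ : _ - x = i) //; ring.
rewrite (_ : _ - y = - j); first exact: idealN.
by rewrite (_ : y = x + (i + j)); [ring | rewrite ij; ring].
Qed.

End ConstructibleIdeals.

(** * Equivalence of the two presentations *)

Section StarLemmas.
Variables (RR : realType) (A : cstarAlgType RR).
Implicit Types x y : A.

Lemma isometry_idempotent x : Defs.isometry x -> x * x = x -> x = 1.
Proof. by rewrite /Defs.isometry => ix xx; rewrite -[x]mul1r -ix -mulrA xx. Qed.

Lemma star0 : star (0 : A) = 0.
Proof. by apply: (addrI (star (0 : A))); rewrite -starD !addr0. Qed.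

Lemma star1 : star (1 : A) = 1.
Proof. by rewrite -[LHS]mulr1 -{2}(starK (1 : A)) -starM mulr1 starK. Qed.

Lemma isometry_right_inverse x y :
  Defs.isometry x -> x * y = 1 -> unitary x /\ star x = y.
Proof.
rewrite /unitary /Defs.isometry => ix xy.
have sx : star x = y by rewrite -[LHS]mulr1 -xy mulrA ix mul1r.
by split=> //; split=> //; rewrite sx.
Qed.

End StarLemmas.

Section TwoPresentations.
Variables (RR : realType) (K : fieldExtType rat) (m : modulus K RR).
Variables (Gamma : set (residue m)) (hG : residue_subgroup Gamma).
Local Notation R := (@int_ring K).
Local Notation C := (congruence_monoid Gamma).
Local Notation P := (affine_semigroup Gamma).
Implicit Types (x y z a b : K) (I J : set K) (X : set (affine K)).

Section FromSemigroup.
Variables (A : cstarAlgType RR) (v : affine K -> A) (e : set (affine K) -> A).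
Variable rel : semigroup_relations P v e.
Let u x := v (aff x 1).
Let s a := v (aff 0 a).
Let eI I := e (affine_ideal Gamma I).
Local Notation C_neq0 := congruence_monoid_neq0.

Let Pu x : R x -> P (aff x 1).
Proof.
move=> Rx; apply/(affine_semigroupE _ _ (oner_neq0 K)); split=> //.
exact: congruence_monoid1.
Qed.

Let Ps a : C a -> P (aff 0 a).
Proof.
move=> Ca; apply/(affine_semigroupE _ _ (C_neq0 Ca)); split=> //.
exact: int_ring0.
Qed.

Lemma semigroup_rel_v1 : v 1%g = 1.
Proof.
have P1 : P 1%g by rewrite -aff01; apply/Pu/int_ring0.
apply: isometry_idempotent; first exact: (rel_isometry rel).
by rewrite (rel_vM rel) // mulg1.
Qed.

Lemma semigroup_rel_uD x y : R x -> R y -> u x * u y = u (x + y).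
Proof.
by move=> Rx Ry; rewrite /u (rel_vM rel) ?affM ?oner_neq0 ?mul1r; try exact: Pu.
Qed.

Lemma semigroup_rel_unitary x : R x -> unitary (u x) /\ star (u x) = u (- x).
Proof.
move=> Rx; apply: isometry_right_inverse; first exact/(rel_isometry rel)/Pu.
rewrite semigroup_rel_uD //; last exact: int_ringN.
by rewrite subrr /u aff01 semigroup_rel_v1.
Qed.

(** With [semigroup_rel_split], this expresses all the generators of the semigroup
    algebra through [u], [s] and [eI]. *)
Lemma semigroup_rel_coset x I : R x -> ideals_coprime m I ->
  u x * eI I * star (u x) = e (affine_coset Gamma x I).
Proof.
move=> Rx cI; rewrite (rel_ve rel); last exact: constructible_affine_ideal.
  by rewrite ltranslate_affine_ideal.
exact: Pu.
Qed.

Lemma semigroup_rel_split b a : R b -> C a -> v (aff b a) = u b * s a.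
Proof.
move=> Rb Ca; rewrite (rel_vM rel); [|exact: Pu|exact: Ps].
by rewrite -aff_split // (C_neq0 Ca).
Qed.

Lemma semigroup_relations_T : relations_T Gamma u s eI.
Proof.
have cst I : ideals_coprime m I -> constructible P (affine_ideal Gamma I).
  exact: constructible_affine_ideal.
have conj x I : R x -> ideals_coprime m I ->
    u x * eI I = e (affine_coset Gamma x I) * u x.
  move=> Rx cI; rewrite -semigroup_rel_coset // -!mulrA.
  by have [[-> _] _] := semigroup_rel_unitary Rx; rewrite mulr1.
split.
- split.
  + by move=> x Rx; have [] := semigroup_rel_unitary Rx.
  + exact: semigroup_rel_uD.
  + by move=> a Ca; apply/(rel_isometry rel)/Ps.
  + move=> a b Ca Cb; rewrite /s (rel_vM rel); [|exact: Ps|exact: Ps].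
    by rewrite affM ?(C_neq0 Ca) ?(C_neq0 Cb) // mulr0 addr0.
  + move=> a x Ca Rx; rewrite /s /u !(rel_vM rel) ?aff_commute ?(C_neq0 Ca) //;
      try exact: Ps; apply: Pu => //.
    by apply: int_ringM => //; apply: congruence_monoid_int Ca.
- split.
  + by move=> I cI; apply/(rel_projection rel)/cst.
  + move=> I J cI cJ; rewrite /eI (rel_eI rel); try exact: cst.
    congr e; apply/seteqP; split=> g.
      by move=> [[? [? ?]] [? [? ?]]].
    by move=> [[? ?] [[? ?] ?]].
  + by rewrite /eI affine_ideal_int_ring (rel_eT rel).
- move=> a I Ca cI; rewrite /s /eI (rel_ve rel); [|exact: Ps|exact: cst].
  rewrite -!affine_coset0 (ltranslate_affine_coset hG) //; last exact: Ps.
  by rewrite val_aff ?(C_neq0 Ca) //= mulr0 addr0.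
- split=> [I x cI Ix|I x cI [Rx nIx]]; have [idI _ _] := cI.
  + rewrite conj //; last exact: ideal_sub Ix.
    congr (e _ * _); rewrite -affine_coset0.
    apply/seteqP; split=> g [Ig Cg]; split=> //.
      by rewrite subr0 -[(val g).1](subrK x); apply: idealD.
    by rewrite subr0 in Ig; apply: idealB.
  + rewrite -mulrA conj // mulrA -semigroup_rel_coset //.
    rewrite {1}/eI semigroup_rel_coset // (rel_eI rel);
      [|exact: cst|]; last first.
      rewrite -ltranslate_affine_ideal //; apply: constructibleM; first exact: Pu.
      exact: cst.
    rewrite (_ : _ `&` _ = set0) ?(rel_e0 rel) ?mul0r //.
    apply/seteqP; split=> // g [[Ig _] [Igx _]]; apply: nIx.
    by rewrite (_ : x = (val g).1 - ((val g).1 - x)); [apply: idealB | ring].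
Qed.

End FromSemigroup.

Section FromT.
Variables (B : cstarAlgType RR) (U S : K -> B) (E : set K -> B).
Hypothesis rel : relations_T Gamma U S E.

Let Ta : relations_Ta Gamma U S. Proof. by case: rel. Qed.
Let Tb : relations_Tb m E. Proof. by case: rel. Qed.
Let Tc : relations_Tc Gamma S E. Proof. by case: rel. Qed.
Let Td : relations_Td m U E. Proof. by case: rel. Qed.

Lemma rel_T_U0 : U 0 = 1.
Proof.
apply: isometry_idempotent; first by case: (Ta_unitary Ta (int_ring0 K)).
by rewrite (Ta_uD Ta) ?addr0 //; apply: int_ring0.
Qed.

Lemma rel_T_S1 : S 1 = 1.
Proof.
have C1 := congruence_monoid1 hG.
apply: isometry_idempotent; first exact: (Ta_isometry Ta).
by rewrite (Ta_sM Ta) ?mulr1.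
Qed.

Lemma rel_T_starU x : R x -> star (U x) = U (- x).
Proof.
move=> Rx; have RNx := int_ringN Rx; have [ix _] := Ta_unitary Ta Rx.
have [] // := isometry_right_inverse (y := U (- x)) ix.
by rewrite (Ta_uD Ta) // subrr rel_T_U0.
Qed.

(** The image of [e_X] for [X = affine_coset x I], under the homomorphism to be
    constructed. *)
Definition coset_projection x I : B := U x * E I * star (U x).

Lemma coset_projection_eq x y I : R x -> R y -> ideals_coprime m I -> I (x - y) ->
  coset_projection x I = coset_projection y I.
Proof.
move=> Rx Ry cI Ixy; rewrite /coset_projection.
have Rxy := int_ringB Rx Ry.
have -> : U x = U y * U (x - y) by rewrite (Ta_uD Ta) // subrKC.
rewrite -(mulrA (U y)) (Td_in Td) // starM !mulrA -(mulrA _ (U (x - y))).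
by have [_ ->] := Ta_unitary Ta Rxy; rewrite mulr1.
Qed.

Lemma coset_projection_mul x y I J : R x -> R y ->
  coset_projection x I * coset_projection y J
  = U x * (E I * U (y - x) * E J) * star (U y).
Proof.
move=> Rx Ry; rewrite /coset_projection.
have RNx := int_ringN Rx.
have -> : U (y - x) = star (U x) * U y.
  by rewrite rel_T_starU // (Ta_uD Ta) // addrC.
by rewrite !mulrA.
Qed.

Lemma coset_projection_projection x I : R x -> ideals_coprime m I ->
  projection (coset_projection x I).
Proof.
move=> Rx cI; have [sE EE] := Tb_projection Tb cI; split.
  by rewrite /coset_projection !starM starK sE mulrA.
by rewrite coset_projection_mul // subrr rel_T_U0 mulr1 EE.
Qed.

Lemma coset_projection_cap x I J :
  R x -> ideals_coprime m I -> ideals_coprime m J ->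
  coset_projection x I * coset_projection x J = coset_projection x (I `&` J).
Proof.
move=> Rx cI cJ.
by rewrite coset_projection_mul // subrr rel_T_U0 mulr1 (Tb_eI Tb).
Qed.

(** The relations only say that [E L U^d E L = 0] for [d] outside [L]. For two
    different ideals, take [L = I + J]: it is coprime to the modulus, and [E I]
    and [E J] are both below [E L]. *)
Lemma coset_projection_disjoint x y I J : R x -> R y ->
  ideals_coprime m I -> ideals_coprime m J -> ~ ideal_add I J (y - x) ->
  coset_projection x I * coset_projection y J = 0.
Proof.
move=> Rx Ry cI cJ nIJ; have [[idI _ _] [idJ _ _]] := (cI, cJ).
have cIJ := ideals_coprime_add hG cI idJ.
have EI : E I = E I * E (ideal_add I J).
  rewrite (Tb_eI Tb) //; congr E; apply/seteqP; split=> [z Iz|z []//].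
  by split=> //; exists z => //; exists 0; [exact: ideal0 | rewrite addr0].
have EJ : E J = E (ideal_add I J) * E J.
  rewrite (Tb_eI Tb) //; congr E; apply/seteqP; split=> [z Jz|z []//].
  by split=> //; exists 0; [exact: ideal0 | exists z; rewrite ?add0r].
have H : E (ideal_add I J) * U (y - x) * E (ideal_add I J) = 0.
  by apply: (Td_out Td) => //; split=> //; apply: int_ringB.
rewrite coset_projection_mul // EI EJ.
have -> : E I * E (ideal_add I J) * U (y - x) * (E (ideal_add I J) * E J)
    = E I * (E (ideal_add I J) * U (y - x) * E (ideal_add I J)) * E J.
  by rewrite !mulrA.
by rewrite H mulr0 !mul0r mulr0 mul0r.
Qed.

Lemma coset_projection_translate b a x I :
  R b -> C a -> R x -> ideals_coprime m I ->
  (U b * S a) * coset_projection x I * star (U b * S a)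
  = coset_projection (b + a * x) (scale a I).
Proof.
move=> Rb Ca Rx cI; have Rax := int_ringM (congruence_monoid_int Ca) Rx.
have W : U b * S a * U x = U (b + a * x) * S a.
  by rewrite -mulrA (Ta_su Ta) // mulrA (Ta_uD Ta).
have W' : star (U x) * star (U b * S a) = star (S a) * star (U (b + a * x)).
  by rewrite -!starM W.
transitivity (U b * S a * U x * E I * (star (U x) * star (U b * S a))).
  by rewrite /coset_projection !mulrA.
by rewrite W W' /coset_projection -(Tc Ca cI) !mulrA.
Qed.

Definition semigroup_isometry (g : affine K) : B := U (val g).1 * S (val g).2.

(** The choice of [x] and [I] is immaterial by [affine_coset_inj] and
    [coset_projection_eq]. *)
Definition semigroup_projection X : B :=
  if pselect (exists xI : K * set K, [/\ R xI.1, ideals_coprime m xI.2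
    & X = affine_coset Gamma xI.1 xI.2]) is left h
  then coset_projection (projT1 (cid h)).1 (projT1 (cid h)).2 else 0.

Lemma semigroup_projection_coset x I : R x -> ideals_coprime m I ->
  semigroup_projection (affine_coset Gamma x I) = coset_projection x I.
Proof.
move=> Rx cI; rewrite /semigroup_projection.
case: pselect => [h|[]]; last by exists (x, I).
case: (cid h) => -[y J] /= [Ry cJ /(affine_coset_inj hG cI cJ) [IJ Ixy]].
by rewrite -IJ; apply/esym/coset_projection_eq.
Qed.

Lemma semigroup_projection0 : semigroup_projection set0 = 0.
Proof.
rewrite /semigroup_projection; case: pselect => // h; exfalso.
have [[x I] /= [Rx cI E0]] := h.
exact: (affine_coset_nonempty hG cI (esym E0)).
Qed.

Lemma T_semigroup_relations :
  semigroup_relations P semigroup_isometry semigroup_projection.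
Proof.
have cP := constructible_affine_coset hG.
split.
- move=> p [Rp Cp]; rewrite /Defs.isometry starM mulrA -(mulrA _ (star _)).
  by have [-> _] := Ta_unitary Ta Rp; rewrite mulr1; apply: (Ta_isometry Ta).
- move=> X /cP[->|[x [I [Rx cI ->]]]].
    by rewrite semigroup_projection0; split; rewrite ?star0 ?mulr0.
  by rewrite semigroup_projection_coset //; apply: coset_projection_projection.
- move=> p q [Rp Cp] [Rq Cq]; rewrite /semigroup_isometry val_mulg /=.
  have Rpq := int_ringM (congruence_monoid_int Cp) Rq.
  rewrite mulrA -(mulrA _ (S _)) (Ta_su Ta) // mulrA (Ta_uD Ta) //.
  by rewrite -mulrA (Ta_sM Ta).
- move=> p X Pp; have [Rp Cp] := Pp => /cP[->|[x [I [Rx cI ->]]]].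
    by rewrite /ltranslate image_set0 semigroup_projection0 mulr0 mul0r.
  rewrite (ltranslate_affine_coset hG) // !semigroup_projection_coset //.
  + exact: coset_projection_translate.
  + apply: int_ringD => //; apply: int_ringM => //.
    exact: congruence_monoid_int Cp.
  + exact: (ideals_coprime_scale hG).
- exact: semigroup_projection0.
- rewrite -affine_ideal_int_ring -affine_coset0 semigroup_projection_coset.
  + by rewrite /coset_projection rel_T_U0 (Tb_e1 Tb) !mul1r star1.
  + exact: int_ring0.
  + exact: (ideals_coprime_int_ring hG).
- move=> X Y /cP[->|[x [I [Rx cI ->]]]].
    by rewrite set0I semigroup_projection0 mul0r.
  move=> /cP[->|[y [J [Ry cJ ->]]]].
    by rewrite setI0 semigroup_projection0 mulr0.
  have [[idI _ _] [idJ _ _]] := (cI, cJ).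
  have cIJ := ideals_coprime_cap hG cI cJ.
  rewrite !semigroup_projection_coset //.
  have [E0|[z [Rz Iz Jz ->]]] := affine_coset_cap Gamma y Rx idI idJ.
    rewrite E0 semigroup_projection0; apply: coset_projection_disjoint => //.
    exact: affine_coset_disjoint E0.
  rewrite semigroup_projection_coset // -coset_projection_cap //.
  congr (_ * _); apply: coset_projection_eq => //;
    by rewrite -opprB; apply: idealN.
Qed.

End FromT.
End TwoPresentations.

Theorem proposition4p3 (RR : realType) (K : fieldExtType rat)
    (m : modulus K RR) (Gamma : set (residue m)) (hGamma : residue_subgroup Gamma)
    (A : cstarAlgType RR) (v : affine K -> A) (e : set (affine K) -> A)
    (hA : is_semigroup_cstar (affine_semigroup Gamma) v e) :
  let u (x : K) : A := v (aff x 1%R) in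
  let s (a : K) : A := v (aff 0%R a) in
  let eI (I : set K) : A := e (affine_ideal Gamma I) in
  relations_T Gamma u s eI /\
  forall (B : cstarAlgType RR) (U S : K -> B) (E : set K -> B),
    relations_T Gamma U S E ->
    exists! f : A -> B,
      [/\ star_hom f,
          forall x, int_ring x -> f (u x) = U x,
          forall a, congruence_monoid Gamma a -> f (s a) = S a
        & forall I, ideals_coprime m I -> f (eI I) = E I].
Proof.
move=> u s eI; have [relA univ] := hA.
split; first exact: semigroup_relations_T.
move=> B U S E relB; have [Ta _ _ _] := relB.
have C1 := congruence_monoid1 hGamma; have R0 := int_ring0 K.
have [f [[hf fv fe] uniq_f]] := univ B _ _ (T_semigroup_relations hGamma relB).
exists f; split.
  split=> // [x Rx|a Ca|I cI].
  - rewrite fv; last by apply/affine_semigroupE; rewrite ?oner_neq0.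
    rewrite /semigroup_isometry val_aff ?oner_neq0 //=.
    by rewrite (rel_T_S1 hGamma relB) mulr1.
  - have a0 := congruence_monoid_neq0 Ca.
    rewrite fv; last by apply/affine_semigroupE.
    by rewrite /semigroup_isometry val_aff //= (rel_T_U0 relB) mul1r.
  - rewrite fe; last exact: constructible_affine_ideal.
    rewrite -affine_coset0 (semigroup_projection_coset hGamma relB) //.
    by rewrite /coset_projection (rel_T_U0 relB) mul1r star1 mulr1.
move=> g [hg gu gs ge]; apply: uniq_f.
split=> // [p [Rp Cp]|X /(constructible_affine_coset hGamma)].
  have [_ gM _] := hg.
  by rewrite -{1}[p]aff_val (semigroup_rel_split hGamma relA) // gM gu // gs.
have [glin gM gstar] := hg.
case=> [->|[x [I [Rx cI ->]]]].
  rewrite (semigroup_projection0 hGamma) (rel_e0 relA).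
  have := glin 1 0 0; rewrite !scale1r addr0 => /(congr1 (fun z => z - g 0)).
  by rewrite addrK subrr => ->.
rewrite (semigroup_projection_coset hGamma relB) //.
rewrite -(semigroup_rel_coset hGamma relA) //.
by rewrite !gM gstar gu // ge.
Qed.
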